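(* Let $n,m\ge0$ be integers and let $\lambda,\mu$ be partitions with $\mu\subset\lambda$ and $\ell(\lambda)\le n$. Then \[ |\mathrm{LHT}_{n,m}(\lambda/\mu)| = m^{|\lambda/\mu|}\frac{|\mathrm{SYT}(\lambda/\mu)|}{|\lambda/\mu|!}\prod_{x\in\lambda/\mu}(n+c(x)). \] In particular, the number of $n$-lecture hall tableaux of shape $\lambda$ whose maximum entry is less than $nm$ is \[ |\mathrm{LHT}_{n,m}(\lambda)| = m^{|\lambda|}\,|\mathrm{SSYT}_n(\lambda)| = m^{|\lambda|}\prod_{x\in\lambda}\frac{n+c(x)}{h(x)}. \]
   Context: $\mathbb N=\{0,1,2,\dots\}$. A partition $\lambda$ is identified with its Young diagram $\{(i,j):1\le i\le \ell(\lambda),\,1\le j\le\lambda_i\}$, where $\ell(\lambda)$ is the number of (positive) parts; $\mu\subset\lambda$ means containment of diagrams, $\lambda/\mu$ is the set difference, and $|\lambda/\mu|$ its number of cells; $\lambda=\lambda/\emptyset$. The content of a cell is $c(i,j)=j-i$ and the hook length in $\lambda$ is $h(i,j)=\lambda_i+\lambda_j'-i-j+1$, where $\lambda'_j=\#\{r:\lambda_r\ge j\}$. A tableau of shape $\lambda/\mu$ is a map $\lambda/\mu\to\mathbb N$. $\mathrm{SYT}(\lambda/\mu)$: the set of tableaux of shape $\lambda/\mu$ in which each integer $1,\dots,|\lambda/\mu|$ appears exactly once and entries decrease along each row and each column. $\mathrm{SSYT}_n(\lambda)$: the set of tableaux of shape $\lambda$ with entries in $\{0,1,\dots,n-1\}$,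 weakly decreasing along rows and strictly decreasing down columns. An $n$-lecture hall tableau of shape $\lambda/\mu$ is a tableau $L$ of shape $\lambda/\mu$ such that \[ \frac{L(i,j)}{n+c(i,j)}\ge\frac{L(i,j+1)}{n+c(i,j+1)},\qquad \frac{L(i,j)}{n+c(i,j)}>\frac{L(i+1,j)}{n+c(i+1,j)} \] whenever the cells involved lie in $\lambda/\mu$. For such $L$, $\lfloor L\rfloor$ denotes the tableau of shape $\lambda/\mu$ whose $(i,j)$-entry is $\lfloor L(i,j)/(n-i+j)\rfloor$. $\mathrm{LHT}_{n,m}(\lambda/\mu)$ is the set of $n$-lecture hall tableaux $L$ of shape $\lambda/\mu$ with $\max(\lfloor L\rfloor)<m$, i.e. every entry of $\lfloor L\rfloor$ is less than $m$. Convention: $0^0=1$.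
   Formalization: ''Maximum entry less than nm'' is read as L(1,1) < nm, the entry with largest ratio L(i,j)/(n+c(i,j)) (no condition if λ is empty); with the largest value the claim fails: n=1, m=2, λ=(2) gives 3 tableaux, not 4. *)

(* Defs.v *)
From HB Require Import structures.
From mathcomp Require Import all_boot all_order all_algebra.
From mathcomp Require Import finmap.
From mathcomp Require Import boolp classical_sets functions cardinality.

Set Implicit Arguments.
Unset Strict Implicit.
Unset Printing Implicit Defensive.

Import Order.TTheory GRing.Theory Num.Theory.

Local Open Scope fset_scope.
Local Open Scope ring_scope.

(* A partition is its sequence of positive parts, so that size la is the
   length of la.  Rows and columns of diagrams are numbered from 1. *)
Definition is_partition (la : seq nat) : bool :=
  sorted geq la && (0%N \notin la).

Definition part (la : seq nat) (i : nat) : nat := nth 0%N la i.-1.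

Definition conj_part (la : seq nat) (j : nat) : nat :=
  count (fun p => (j <= p)%N) la.

Definition diagram (la : seq nat) : {fset nat * nat} :=
  [fset ((i, j) : nat * nat) | i in iota 1 (size la), j in iota 1 (part la i)].

Definition skew_shape (la mu : seq nat) : {fset nat * nat} :=
  diagram la `\` diagram mu.

Definition content (x : nat * nat) : int := x.2%:Z - x.1%:Z.

Definition hook (la : seq nat) (x : nat * nat) : int :=
  (part la x.1)%:Z + (conj_part la x.2)%:Z - x.1%:Z - x.2%:Z + 1.

Definition tableau (D : {fset nat * nat}) := {ffun D -> nat}.

Definition SYT (D : {fset nat * nat}) : set (tableau D) :=
  [set T : tableau D |
    [/\ forall k : nat, (1 <= k <= #|` D|)%N -> exists! x : D, T x = k,
        forall x y : D, (val x).1 = (val y).1 -> ((val x).2 < (val y).2)%N ->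
          (T y < T x)%N
      & forall x y : D, (val x).2 = (val y).2 -> ((val x).1 < (val y).1)%N ->
          (T y < T x)%N]]%classic.

Definition SSYT (n : nat) (D : {fset nat * nat}) : set (tableau D) :=
  [set T : tableau D |
    [/\ forall x : D, (T x < n)%N,
        forall x y : D, (val x).1 = (val y).1 -> ((val x).2 < (val y).2)%N ->
          (T y <= T x)%N
      & forall x y : D, (val x).2 = (val y).2 -> ((val x).1 < (val y).1)%N ->
          (T y < T x)%N]]%classic.

Definition lh_ratio (n : nat) (D : {fset nat * nat}) (L : tableau D) (x : D) :
  rat := (L x)%:R / (n%:Z + content (val x))%:~R.

Definition lecture_hall (n : nat) (D : {fset nat * nat}) (L : tableau D) :
  Prop :=
  (forall x y : D, val y = ((val x).1, (val x).2.+1) ->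
     lh_ratio n L y <= lh_ratio n L x) /\
  (forall x y : D, val y = ((val x).1.+1, (val x).2) ->
     lh_ratio n L y < lh_ratio n L x).

Definition floor_tableau (n : nat) (D : {fset nat * nat}) (L : tableau D)
  (x : D) : int := Num.floor (lh_ratio n L x).

Definition LHT (n m : nat) (D : {fset nat * nat}) : set (tableau D) :=
  [set L : tableau D |
    lecture_hall n L /\ forall x : D, floor_tableau n L x < m%:Z]%classic.

(* Lecture hall tableaux whose entry in cell (1, 1), the cell of largest ratio
   in a straight shape, is less than n m; no condition on the empty shape.
   Bounding all the entries by n m instead can give a smaller set: the
   1-lecture hall tableau (1, 2) of shape (2) is in LHT 1 2. *)
Definition LHT_corner (n m : nat) (D : {fset nat * nat}) : set (tableau D) :=
  [set L : tableau D |
    lecture_hall n L /\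
    forall x : D, val x = (1%N, 1%N) -> (L x < n * m)%N]%classic.

Arguments SYT : clear implicits.
Arguments SSYT : clear implicits.
Arguments LHT : clear implicits.
Arguments LHT_corner : clear implicits.

(* fset_set is the empty set on infinite sets; the lemmas finite_SYT,
   finite_SSYT, finite_LHT and finite_LHT_corner below show that this value is
   not reached in the cases of interest. *)
Definition ncard (T : choiceType) (A : set T) : nat := #|` fset_set A|.

Lemma diagramP (la : seq nat) (x : nat * nat) :
  (x \in diagram la) =
  [&& 1 <= x.1, x.1 <= size la, 1 <= x.2 & x.2 <= part la x.1]%N.
Proof.
apply/imfset2P/idP => /= [[i]|].
  rewrite mem_iota add1n ltnS => /andP[i1 il] [j].
  by rewrite mem_iota add1n ltnS => /andP[j1 jl] ->; rewrite /= i1 il j1 jl.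
case: x => i j /= /and4P[i1 il j1 jl].
exists i; first by rewrite /= mem_iota add1n ltnS i1.
by exists j => //; rewrite /= mem_iota add1n ltnS j1.
Qed.

Lemma finite_tableaux (D : {fset nat * nat}) (A : set (tableau D))
    (b : D -> nat) :
  (forall T, A T -> forall x, (T x <= b x)%N) -> finite_set A.
Proof.
move=> Ab; pose B := \max_(x : D) b x.
pose F (f : {ffun D -> 'I_B.+1}) : tableau D := [ffun x => f x : nat].
apply: (@sub_finite_set _ _ (F @` setT)%classic); last first.
  by apply: finite_image; exact: finite_finset.
move=> T AT; exists [ffun x => inord (T x)] => //.
apply/ffunP => x; rewrite !ffunE inordK // ltnS.
by apply: leq_trans (Ab _ AT x) _; apply: leq_bigmax.
Qed.

Lemma finite_SSYT (n : nat) (D : {fset nat * nat}) : finite_set (SSYT n D).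
Proof.
by apply: (@finite_tableaux _ _ (fun=> n)) => T [Tn _ _] x; apply/ltnW.
Qed.

Lemma finite_SYT (D : {fset nat * nat}) : finite_set (SYT D).
Proof.
apply: (@finite_tableaux _ _ (fun=> #|` D|)) => T [TN _ _].
have P (k : 'I_#|` D|) : exists x : D, T x = k.+1.
  by case: (TN k.+1) => [|x [Tx _]]; [exact: ltn_ord | exists x].
have [f fP] := choice P.
have f_inj : injective f.
  by move=> k l fkl; apply/val_inj; move: (fP k); rewrite fkl fP => -[].
have f_surj : forall x : D, exists k, x = f k.
  move=> x; have cardle : (#|{: D}| <= #|{: 'I_(#|` D|)}|)%N.
    by rewrite card_ord cardfE.
  by have /codomP[k ->] := inj_card_onto f_inj cardle x; exists k.
by move=> x; have [k ->] := f_surj x; rewrite fP ltn_ord.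
Qed.

Lemma denominator_gt0 (n : nat) (la : seq nat) (x : nat * nat) :
  (size la <= n)%N -> x \in diagram la -> 0 < n%:Z + content x.
Proof.
move=> len; rewrite diagramP => /and4P[_ x1 x2 _].
rewrite /content addrA subr_gt0 -PoszD ltz_nat.
by apply: leq_ltn_trans (leq_trans x1 len) _; rewrite -addn1 leq_add2l.
Qed.

Lemma finite_LHT (n m : nat) (la : seq nat) (D : {fset nat * nat}) :
  (size la <= n)%N -> D `<=` diagram la -> finite_set (LHT n m D).
Proof.
move=> len /fsubsetP Dla.
pose b (x : D) := `|(m%:Z * (n%:Z + content (val x)))%R|%N.
apply: (@finite_tableaux _ _ b) => L [_ Lm] x.
have xla : val x \in diagram la by exact: Dla (valP x).
have d0 := denominator_gt0 len xla.
have := Lm x.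
rewrite /floor_tableau floor_lt_int /lh_ratio ltr_pdivrMr ?ltr0z //.
rewrite -intrM -[(L x)%:R]/((L x)%:Z%:~R) ltr_int => /ltW.
rewrite /b -lez_nat gez0_abs //.
by rewrite mulr_ge0 // ltW.
Qed.

Lemma lh_ratio_le_corner (n : nat) (la : seq nat) (L : tableau (diagram la))
    (x : diagram la) :
  is_partition la -> lecture_hall n L ->
  exists2 y : diagram la, val y = (1%N, 1%N) & lh_ratio n L x <= lh_ratio n L y.
Proof.
move=> /andP[la_sorted _] [Lrow Lcol].
move: {2}((val x).1 + (val x).2)%N (leqnn ((val x).1 + (val x).2)%N) => k.
elim: k x => [|k IH] x; have := valP x; rewrite diagramP;
  case Ex: (val x) => [i j] /= /and4P[i1 il j1 jl].
  by rewrite leqNgt addn_gt0 i1.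
have step (z : nat * nat) : z \in diagram la -> (z.1 + z.2 <= k)%N ->
    (forall y : diagram la, val y = z -> lh_ratio n L x <= lh_ratio n L y) ->
  exists2 y : diagram la, val y = (1%N, 1%N) & lh_ratio n L x <= lh_ratio n L y.
  move=> zla zk xz; have [y y11 zy] := IH [` zla] zk.
  by exists y => //; apply: le_trans zy; exact: xz.
move: j1; rewrite leq_eqVlt => /orP[/eqP j1|j2] ijk.
  move: i1; rewrite leq_eqVlt => /orP[/eqP i1|i2].
    by exists x; rewrite ?Ex -?i1 -?j1.
  apply: (step (i.-1, j)) => [||y Ey]; last 1 first.
  - apply/ltW/Lcol; rewrite Ex Ey /= prednK //; exact: ltnW.
  - rewrite diagramP /= -ltnS prednK ?(ltnW i2) // i2 -j1.
    rewrite (leq_trans (leq_pred _) il) /= /part.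
    have geq_trans : transitive geq.
      by move=> a b c ba cb; exact: leq_trans cb ba.
    rewrite -j1 in jl; apply: leq_trans jl _.
    apply: (sorted_leq_nth geq_trans leqnn 0%N la_sorted); last exact: leq_pred.
    + by apply: leq_ltn_trans (leq_pred _) _; rewrite prednK ?(ltnW i2).
    + by rewrite inE prednK ?(ltnW i2).
  - by rewrite -ltnS (leq_trans _ ijk) // ltn_add2r prednK // ltnW.
apply: (step (i, j.-1)) => [||y Ey]; last 1 first.
- apply: Lrow; rewrite Ex Ey /= prednK //; exact: ltnW.
- rewrite diagramP /= i1 il (leq_trans (leq_pred _) jl) andbT.
  by rewrite -ltnS prednK // ltnW.
- by rewrite -ltnS (leq_trans _ ijk) // ltn_add2l prednK // ltnW.
Qed.

Lemma finite_LHT_corner (n m : nat) (la : seq nat) :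
  is_partition la -> (size la <= n)%N ->
  finite_set (LHT_corner n m (diagram la)).
Proof.
move=> la_part len.
pose b (x : diagram la) := `|((n * m)%:Z * (n%:Z + content (val x)))%R|%N.
apply: (@finite_tableaux _ _ b) => L [Llh L11] x.
have [y y11 xy] := lh_ratio_le_corner x la_part Llh.
have d0 := denominator_gt0 len (valP x).
have : lh_ratio n L x <= (n * m)%:R.
  apply: le_trans xy _; rewrite /lh_ratio y11 /content subrr addr0.
  have := denominator_gt0 len (valP y); rewrite y11 /content subrr addr0 => n0.
  rewrite ler_pdivrMr ?ltr0z // -[n%:Z%:~R]/(n%:R) -natrM ler_nat.
  by rewrite (leq_trans (ltnW (L11 _ y11))) // leq_pmulr.
rewrite /lh_ratio ler_pdivrMr ?ltr0z //.
rewrite -[(n * m)%:R]/((n * m)%:Z%:~R) -intrM.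
rewrite -[(L x)%:R]/((L x)%:Z%:~R) ler_int.
by rewrite /b -lez_nat gez0_abs // mulr_ge0 // ltW.
Qed.

(* Main.v *)
Require Import Defs.
From mathcomp Require Import all_boot all_order all_algebra.
From mathcomp Require Import finmap.
From mathcomp Require Import boolp classical_sets cardinality.
From mathcomp Require Import fintype finset perm.
From mathcomp Require Import zify ring.

Set Implicit Arguments.
Unset Strict Implicit.
Unset Printing Implicit Defensive.

Import Order.TTheory GRing.Theory Num.Theory.

(** Both kinds of tableaux are turned into fillings of the skew shape by
distinct times, increasing along rows and down columns, in which only some
pairs (time, cell) are allowed.  Reading a filling in the order of its times
makes mu grow into la one cell at a time, so the number of fillings satisfies
a recursion over time: at each time, either nothing happens or one allowed
cell is added ([card_fillings_step], [card_fillings_unique]).  For an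
intermediate partition p, put q_i = p_i + n - i and l_i = la_i + n - i, with
rows numbered from 1.  Adding a cell to row i raises q_i by one, and the
recursion is solved by determinants with entries v_j (l_i, q_j): when the new
cell would break the partition, the determinant has two equal rows or a zero
block that is too large ([det_grid_not_addable]).

Standard tableaux of size N become, after complementation of the entries, the
fillings by the times 0, ..., N - 1 without further restriction.  The entries
1 / (l - q)! solve the recursion, since passing from q to q + 1 multiplies
them by l - q; summing over the row where this happens multiplies the
determinant by the number of missing cells ([invfact_det_sum]).  Hence the
number of standard tableaux is N! times det (1 / (l_i - q_j)!), taken at
p = mu.

For lecture hall tableaux let a = n + c(x) and L(x) = v a + r with r < a.
The time of x has three digits: m - 1 - v, then a - 1 - r in a base M greater
than all the a, then the row of x in base n.  The denominators of adjacent
cells differ by one, and the comparison of their ratios is exactly the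
comparison of their times ([lh_ratio_time]).  A time is allowed for the next
cell of row i when its last digit is that row and its middle digit is at most
q_i.  Each time concerns one row only, so a step of the recursion modifies one
row of the determinant, whose entries count the ways in which one row grows
from q to l; one block of M time steps contributes one to the base of the
power in binomial(l, q) m^(l - q) ([paths_blocks]).  This entry equals
m^(l - q) (l! / q!) / (l - q)!, so that the determinant is m^N times the
quotient of all l_i! by all q_i!, which is the product of the n + c(x), times
the determinant found for standard tableaux.

On a straight shape with m = 1 all the floors vanish and the ratio
inequalities amount to the plain ones, so these tableaux are the semistandard
ones.  Let f be the number of standard tableaux.  The hook formula comes from
the same determinants: they give a value of f / N! for every n at least the
number of rows.  If n is the number of rows,
Pascal's rule is multiplication by a unitriangular matrix and shows that
det binomial(l_i, n - j) is unchanged when every l_i is lowered by one, that is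
when the first column is removed ([lh_det_pascal]).  So f / N! gets divided by
the product of the l_i, which are the hook lengths of the first column. *)

(** * Increasing fillings of a finite set *)

Section Fillings.
Variables (X : finType) (prec : rel X) (A : nat -> pred X) (T : nat).

(** The cells of [I] are those occupied before time [tau]; giving them all the
value [ord0] makes a filling determined by its restriction to the others. *)
Definition fillings (tau : nat) (I : {set X}) : {set {ffun X -> 'I_T.+1}} :=
  [set F : {ffun X -> 'I_T.+1} |
    [&& [forall x, (x \in I) ==> (F x == ord0)],
        [forall x, (x \notin I) ==> (tau <= F x < T) && A (F x) x],
        [forall x, forall y, [&& x \notin I, y \notin I & F x == F y]
           ==> (x == y)] &
        [forall x, forall y, [&& x \notin I, y \notin I & prec x y]
           ==> (F x < F y)]]].

Lemma fillingsP (tau : nat) (I : {set X}) (F : {ffun X -> 'I_T.+1}) :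
  reflect [/\ forall x, x \in I -> F x = ord0,
              forall x, x \notin I -> (tau <= F x < T) && A (F x) x,
              forall x y, x \notin I -> y \notin I -> F x = F y -> x = y &
              forall x y, x \notin I -> y \notin I -> prec x y -> F x < F y]
          (F \in fillings tau I).
Proof.
rewrite inE; apply: (iffP and4P) => [] [F0 FA Finj Fprec]; split.
- by move=> x xI; apply/eqP; move/forallP: F0 => /(_ x); rewrite xI.
- by move=> x xI; move/forallP: FA => /(_ x); rewrite xI.
- move=> x y xI yI Fxy; apply/eqP.
  by move/forallP: Finj => /(_ x) /forallP /(_ y); rewrite xI yI Fxy eqxx.
- move=> x y xI yI xy.
  by move/forallP: Fprec => /(_ x) /forallP /(_ y); rewrite xI yI xy.
- by apply/forallP => x; apply/implyP => /F0 ->.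
- by apply/forallP => x; apply/implyP => /FA.
- apply/forallP => x; apply/forallP => y; apply/implyP => /and3P[xI yI /eqP].
  by move/(Finj _ _ xI yI) ->.
- apply/forallP => x; apply/forallP => y; apply/implyP => /and3P[xI yI].
  exact: Fprec.
Qed.

Lemma card_fillings_end (I : {set X}) : #|fillings T I| = (I == [set: X]).
Proof.
case: eqP => [->|/eqP IT].
  transitivity #|[set [ffun=> ord0 : 'I_T.+1] : {ffun X -> 'I_T.+1}]|;
    last exact: cards1.
  congr #|pred_of_set _|.
  apply/setP => F; rewrite in_set1; apply/fillingsP/eqP => [[F0 _ _ _]|->].
    by apply/ffunP => x; rewrite ffunE F0 ?inE.
  by split => [x _|x|x y|x y]; rewrite ?ffunE ?inE.
apply/eqP; rewrite cards_eq0; apply/eqP/setP => F; rewrite [RHS]inE.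
apply/negbTE/fillingsP => -[_ FA _ _].
case/negP: IT; apply/eqP/setP => x; rewrite inE.
by apply: contraT => /FA; rewrite leqNgt andNb.
Qed.

Definition minimal_off (I : {set X}) (x : X) : bool :=
  (x \notin I) && [forall y, (y \notin I) ==> ~~ prec y x].

Hypothesis prec_irr : irreflexive prec.

(** A filling in which [x] has the least possible time [tau] is a filling of
the remaining cells, plus the information that [x] could come first. *)
Lemma card_fillings_at (tau : nat) (I : {set X}) (x : X) :
  tau < T -> x \notin I ->
  #|[set F in fillings tau I | F x == tau :> nat]| =
  (A tau x && minimal_off I x) * #|fillings tau.+1 (x |: I)|.
Proof.
move=> tauT xI.
case: (boolP (A tau x && _)) => [/andP[Ax /andP[_ /forallP x_min]]|bad];
  last first.
  rewrite mul0n; apply/eqP; rewrite cards_eq0; apply/eqP/setP => F.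
  rewrite inE [RHS]inE.
  apply: contraNF bad => /andP[/fillingsP[_ FA _ Fprec]] /eqP Fx.
  move: (FA x xI); rewrite Fx => /andP[_ ->] /=; rewrite /minimal_off xI /=.
  apply/forallP => y; apply/implyP => yI; apply/negP => yx.
  have := Fprec _ _ yI xI yx; rewrite Fx ltnNge.
  by have /andP[/andP[-> _] _] := FA y yI.
rewrite mul1n.
pose put (v : 'I_T.+1) (F : {ffun X -> 'I_T.+1}) :=
  [ffun y => if y == x then v else F y].
have tauT1 : tau < T.+1 by exact: ltnW.
have putE v F y : put v F y = if y == x then v else F y by rewrite ffunE.
have put_inj : {in [set F in fillings tau I | F x == tau :> nat] &,
                 injective (put ord0)}.
  move=> F G; rewrite inE [G \in _]inE => /andP[_ /eqP Fx] /andP[_ /eqP Gx] FG.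
  apply/ffunP => y; have := congr1 (fun H : {ffun _} => H y) FG.
  by rewrite !putE; case: eqP => [-> _|//]; apply/val_inj; rewrite /= Fx.
rewrite -(card_in_imset put_inj); congr #|pred_of_set _|; apply/setP => G.
apply/imsetP/fillingsP => [[F]|[G0 GA Ginj Gprec]].
  rewrite inE => /andP[/fillingsP[F0 FA Finj Fprec] /eqP Fx] ->.
  have xU y : (y \notin x |: I) = (y != x) && (y \notin I).
    by rewrite !inE negb_or.
  split=> [y|y|y z|y z]; rewrite ?xU.
  - by rewrite !inE putE; case: eqP => //= _ /F0.
  - case/andP=> yx yI; rewrite putE (negbTE yx).
    have /andP[/andP[tauy ->] ->] := FA y yI; rewrite !andbT ltn_neqAle tauy.
    rewrite andbT; apply: contraNneq yx => tauFy; apply/eqP/(Finj y x yI xI).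
    by apply/val_inj; rewrite /= -tauFy Fx.
  - move=> /andP[yx yI] /andP[zx zI].
    by rewrite !putE (negbTE yx) (negbTE zx); exact: Finj.
  - move=> /andP[yx yI] /andP[zx zI].
    by rewrite !putE (negbTE yx) (negbTE zx); exact: Fprec.
have tauG y : y != x -> y \notin I -> tau < G y < T /\ A (G y) y.
  move=> yx yI; apply/andP/GA; by rewrite !inE negb_or yx.
exists (put (Ordinal tauT1) G); last first.
  apply/ffunP => y; rewrite !putE; case: eqP => // ->.
  by rewrite G0 // !inE eqxx.
rewrite inE putE eqxx /= eqxx andbT; apply/fillingsP; split=> [y|y|y z|y z].
- move=> yI; rewrite putE; case: eqP => [yx|_]; first by rewrite -yx yI in xI.
  by rewrite G0 // !inE yI orbT.
- move=> yI; rewrite putE; case: (eqVneq y x) => [-> /=|yx].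
    by rewrite leqnn tauT Ax.
  by have [/andP[/ltnW -> ->] ->] := tauG y yx yI.
- move=> yI zI; rewrite !putE.
  case: (eqVneq y x) (eqVneq z x) => [->|yx] [->|zx] //.
  + move=> /(congr1 val) /= E; have [] := tauG z zx zI.
    by rewrite -E ltnn.
  + move=> /(congr1 val) /= E; have [] := tauG y yx yI.
    by rewrite E ltnn.
  + by apply: Ginj; rewrite !inE negb_or ?yx ?zx.
- move=> yI zI yz; rewrite !putE.
  case: (eqVneq y x) yz (eqVneq z x) => [->|yx] yz [zx|zx] //=.
  + by rewrite zx prec_irr in yz.
  + by have [/andP[]] := tauG z zx zI.
  + by rewrite zx in yz; have := x_min y; rewrite yI yz.
  + by apply: Gprec => //; rewrite !inE negb_or ?yx ?zx.
Qed.

(** Times are distinct, so at most one cell has time [tau]. *)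
Lemma card_fillings_step (tau : nat) (I : {set X}) :
  tau < T ->
  #|fillings tau I| = #|fillings tau.+1 I| +
    \sum_(x | A tau x && minimal_off I x) #|fillings tau.+1 (x |: I)|.
Proof.
move=> tauT.
have sub : fillings tau.+1 I \subset fillings tau I.
  apply/subsetP => F /fillingsP[F0 FA Finj Fprec]; apply/fillingsP.
  by split=> // x /FA /andP[/andP[/ltnW -> ->]].
(* exactly one of the events counted on the right-hand side happens *)
have E F : F \in fillings tau I ->
    (F \in fillings tau.+1 I) + \sum_(x | x \notin I) (F x == tau :> nat) = 1.
  move=> /fillingsP[F0 FA Finj Fprec].
  case: (pickP [pred x | (x \notin I) && (F x == tau :> nat)]) => [x|none].
    move=> /= /andP[xI /eqP Fx].
    rewrite (bigD1 x) //= Fx eqxx big1 ?addn0 => [|y /andP[yI yx]].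
      rewrite (negbTE (_ : F \notin _)) //; apply/fillingsP => -[_ /(_ x xI)].
      by rewrite Fx ltnn.
    apply/eqP; rewrite eqb0; apply: contraNneq yx => Fy; apply/eqP/Finj => //.
    by apply/val_inj; rewrite /= Fx.
  rewrite big1 => [|x xI]; last by have := none x; rewrite /= xI /= => ->.
  rewrite addn0 (_ : F \in _) //; apply/fillingsP; split=> // x xI.
  have /andP[/andP[tauF ->] ->] := FA x xI; rewrite !andbT ltn_neqAle tauF andbT.
  by apply/eqP => tF; have := none x; rewrite /= xI -tF eqxx.
rewrite -sum1_card -(eq_bigr _ E) big_split /=; congr (_ + _).
  rewrite -sum1_card [RHS]big_mkcond /= [LHS]big_mkcond; apply: eq_bigr => F _.
  case FS: (F \in fillings tau.+1 I); first by rewrite (subsetP sub F FS).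
  by case: ifP.
rewrite exchange_big /= [RHS]big_mkcond [LHS]big_mkcond /=.
apply: eq_bigr => x _.
case: ifP => [xI|xI]; last by rewrite /minimal_off xI andbF.
rewrite (_ : \sum_(F in _) _ =
             #|[set F in fillings tau I | F x == tau :> nat]|).
  by rewrite card_fillings_at //; case: ifP; rewrite ?mul1n ?mul0n.
rewrite -sum1_card big_mkcond [RHS]big_mkcond; apply: eq_bigr => F _.
rewrite inE; case: (F \in _) => //=; case: (_ == _) => //.
Qed.

End Fillings.

(** * Growth of a partition inside a skew shape *)

Lemma mem_skew_shape (la mu : seq nat) (x : nat * nat) :
  (x \in skew_shape la mu) =
  (0 < x.1) && (nth 0 mu x.1.-1 < x.2 <= nth 0 la x.1.-1).
Proof.
rewrite in_fsetD !diagramP /part; case: x => [[|i] j] //=.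
have [mu_i|mu_i] := ltnP i (size mu); have [la_i|la_i] := ltnP i (size la);
  rewrite ?(nth_default _ mu_i) ?(nth_default _ la_i) /=; lia.
Qed.

Lemma partition_nth_anti (la : seq nat) (i : nat) :
  is_partition la -> nth 0 la i.+1 <= nth 0 la i.
Proof.
move=> /andP[la_sorted _]; have [i_la|i_la] := ltnP i.+1 (size la); last first.
  by rewrite nth_default.
have geq_trans : transitive geq by move=> a b c ba cb; exact: leq_trans cb ba.
by apply: (sorted_ltn_nth geq_trans 0 la_sorted); rewrite ?inE ?(ltnW i_la).
Qed.

Lemma partition_nth_le (nu : seq nat) (i j : nat) :
  is_partition nu -> i <= j -> nth 0 nu j <= nth 0 nu i.
Proof.
move=> nu_part; elim: j => [|j IH]; first by rewrite leqn0 => /eqP ->.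
rewrite leq_eqVlt => /orP[/eqP -> //|ij].
exact: leq_trans (partition_nth_anti _ nu_part) (IH ij).
Qed.

Section Growth.
Variables (n : nat) (la mu : seq nat).
Hypothesis la_part : is_partition la.
Hypothesis la_len : size la <= n.

Local Notation D := (skew_shape la mu).

Definition adjacent : rel D := fun x y =>
  (val y == ((val x).1, (val x).2.+1)) || (val y == ((val x).1.+1, (val x).2)).

Lemma adjacent_irr : irreflexive adjacent.
Proof.
move=> x; rewrite /adjacent; case: (val x) => i j /=; rewrite !xpair_eqE; lia.
Qed.

(** Partitions are handled as functions on rows numbered from 0, whereas the
cells of diagrams have rows and columns numbered from 1: row [i] of [p] fills
the cells [(i.+1, j)] with [j <= p i]. *)
Definition between (p : nat -> nat) : Prop :=
  (forall i, p i.+1 <= p i) /\ (forall i, nth 0 mu i <= p i <= nth 0 la i).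

Definition inside (p : nat -> nat) : {set D} :=
  [set x : D | (val x).2 <= p (val x).1.-1].

Definition add_cell (p : nat -> nat) (i : nat) : nat -> nat :=
  fun j => p j + (j == i).

Definition addable (p : nat -> nat) (i : nat) : bool :=
  (p i < nth 0 la i) && ((i == 0) || (p i < p i.-1)).

Lemma between_add_cell (p : nat -> nat) (i : nat) :
  between p -> addable p i -> between (add_cell p i).
Proof.
move=> [p_anti p_bd] /andP[pi_la pi_anti]; split=> j; rewrite /add_cell.
  have := p_anti j; case: (eqVneq j.+1 i) pi_anti => [<-|_] /=; last lia.
  by have -> : (j == j.+1) = false; lia.
by have := p_bd j; case: (eqVneq j i) => [->|_]; lia.
Qed.

Lemma minimal_off_inside (p : nat -> nat) (x : D) :
  between p ->
  minimal_off adjacent (inside p) x =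
  ((val x).2 == (p (val x).1.-1).+1) && addable p (val x).1.-1.
Proof.
move=> [p_anti p_bd]; have := valP x; rewrite mem_skew_shape.
case Ex: (val x) => [[|i] j] //= /andP[mu_j j_la].
rewrite /minimal_off inE Ex /= -ltnNge.
have free_prec z : z \in D -> p z.1.-1 < z.2 ->
    (i.+1, j) = (z.1, z.2.+1) \/ (i.+1, j) = (z.1.+1, z.2) ->
    [forall y, (y \notin inside p) ==> ~~ adjacent y x] = false.
  move=> zD pz zx; apply/negbTE/forallPn; exists [` zD]%fset.
  rewrite inE /= -ltnNge pz /= negbK /adjacent Ex /=.
  by case: zx => ->; rewrite eqxx ?orbT.
apply/idP/idP => [/andP[pj x_min]|/andP[/eqP j_p /andP[p_la p_p]]].
  have j_p : j = (p i).+1.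
    apply: contraTeq x_min => j_p; apply/negbT/(free_prec (i.+1, j.-1)) => /=.
    - by rewrite mem_skew_shape /=; have := p_bd i; lia.
    - lia.
    - by left; congr pair; lia.
  rewrite j_p eqxx /= /addable; apply/andP; split; first by lia.
  case: i => [|i] //= in free_prec mu_j j_la pj j_p Ex *.
  apply: contraTT x_min => p_p; apply/negbT/(free_prec (i.+1, j)) => /=.
  - rewrite mem_skew_shape /=; have := p_bd i.
    by have := partition_nth_anti i la_part; lia.
  - lia.
  - by right.
rewrite j_p ltnSn /=; apply/forallP => y; apply/implyP.
rewrite inE -ltnNge => p_y.
apply/negP; rewrite /adjacent Ex.
have := valP y; rewrite mem_skew_shape.
case: (val y) p_y => [[|k] l] //= p_y _ /orP[] /eqP[Ei Ej].
  by move: p_y; rewrite -Ei /=; lia.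
by move: p_p j_p; rewrite Ei -Ej in p_y *; move=> /=; lia.
Qed.

Lemma inside_add_cell (p : nat -> nat) (x : D) :
  (val x).2 = (p (val x).1.-1).+1 ->
  x |: inside p = inside (add_cell p (val x).1.-1).
Proof.
move=> Ex; apply/setP => y; rewrite !inE /add_cell -val_eqE.
have := valP x; have := valP y; rewrite !mem_skew_shape.
move: Ex; case: (val x) (val y) => [[|i] j] [[|k] l] //= -> _ _.
rewrite xpair_eqE eqSS; case: (eqVneq k i) => [->|_] /=; lia.
Qed.

Lemma inside_full (p : nat -> nat) :
  between p -> (inside p == [set: D]) = [forall i : 'I_n, p i == nth 0 la i].
Proof.
move=> [p_anti p_bd]; apply/eqP/forallP => [pT i|p_la]; last first.
  apply/setP => x; rewrite !inE; have := valP x; rewrite mem_skew_shape.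
  case: (val x) => [[|i] j] //= /andP[mu_j j_la].
  have [i_n|i_n] := ltnP i n; last first.
    by rewrite nth_default // in j_la; [lia|exact: leq_trans la_len i_n].
  by have /eqP -> := p_la (Ordinal i_n).
apply: contraTT isT => p_la.
have zD : (i.+1, (p i).+1) \in D.
  by rewrite mem_skew_shape /=; have := p_bd i; lia.
by have /setP /(_ [` zD]%fset) := pT; rewrite !inE /= ltnn.
Qed.

Lemma sum_minimal_off (A : nat * nat -> bool) (p : nat -> nat)
    (f : {set D} -> nat) :
  between p ->
  \sum_(x | A (val x) && minimal_off adjacent (inside p) x) f (x |: inside p) =
  \sum_(i < n | A (i.+1, (p i).+1) && addable p i) f (inside (add_cell p i)).
Proof.
move=> p_bt.
have row_lt (x : D) : (val x).1.-1 < n.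
  have := valP x; rewrite mem_skew_shape; case: (val x) => [[|i] j] //=.
  move=> /andP[mu_j j_la]; rewrite ltnNge; apply/negP => n_i.
  by rewrite nth_default // in j_la; [lia|exact: leq_trans la_len n_i].
rewrite (partition_big (fun x => Ordinal (row_lt x)) xpredT) //=.
rewrite [RHS]big_mkcond; apply: eq_bigr => i _.
have cellE (x : D) : (val x).2 = (p (val x).1.-1).+1 -> (val x).1.-1 = i ->
    val x = (i.+1, (p i).+1).
  have := valP x; rewrite mem_skew_shape.
  by case: (val x) => [[|k] l] //= _ -> ->.
case: ifP => [/andP[Ai p_i]|bad]; last first.
  rewrite big1 // => x /andP[/andP[Ax]]; rewrite minimal_off_inside //.
  move=> /andP[/eqP xp px] /eqP Ei.
  have Ek : (val x).1.-1 = i by rewrite -Ei.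
  by move: bad; rewrite -(cellE x xp Ek) -Ek px Ax.
have zD : (i.+1, (p i).+1) \in D.
  rewrite mem_skew_shape /=; case: p_bt => _ /(_ i); case/andP: p_i; lia.
rewrite (big_pred1 [` zD]%fset) => [|x].
  by rewrite inside_add_cell.
rewrite minimal_off_inside //= -!val_eqE /=.
apply/idP/eqP => [/andP[/andP[Ax /andP[/eqP xp px]] /eqP Ei]|Ex].
  exact: cellE.
by rewrite Ex Ai eqxx p_i /= eqxx.
Qed.

Local Open Scope ring_scope.

(** To count fillings it is enough to guess a function with the right values
at the end and obeying the recursion in which a cell is added to any row, even
where the result is no longer a partition between mu and la, provided that the
guess vanishes there. *)
Theorem card_fillings_unique (A : nat -> nat * nat -> bool) (T : nat)
    (Phi : nat -> (nat -> nat) -> rat) :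
  (forall p, between p ->
     Phi T p = [forall i : 'I_n, p i == nth 0%N la i]%:R) ->
  (forall tau p, (tau < T)%N -> between p ->
     Phi tau p = Phi tau.+1 p +
       \sum_(i < n | A tau (i.+1, (p i).+1)) Phi tau.+1 (add_cell p i)) ->
  (forall tau p (i : 'I_n), (tau < T)%N -> between p ->
     A tau (i.+1, (p i).+1) -> ~~ addable p i ->
     Phi tau.+1 (add_cell p i) = 0) ->
  forall tau p, (tau <= T)%N -> between p ->
    #|fillings adjacent (fun t x => A t (val x)) T tau (inside p)|%:R =
    Phi tau p.
Proof.
move=> Phi_end Phi_step Phi_zero tau p tauT.
rewrite -(subKn tauT); move: (T - tau)%N (leq_subr tau T) => s.
elim: s p => [|s IH] p sT p_bt.
  by rewrite subn0 card_fillings_end inside_full // Phi_end.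
have s_lt : (T - s.+1 < T)%N by lia.
have Es : (T - s.+1).+1 = (T - s)%N by lia.
rewrite card_fillings_step //; last exact: adjacent_irr.
rewrite (sum_minimal_off (A (T - s.+1)%N)
  (fun I => #|fillings adjacent (fun t x => A t (val x)) T
                 (T - s.+1).+1 I|)) //.
rewrite Phi_step // natrD Es IH ?(ltnW sT) //; congr (_ + _).
rewrite natr_sum big_mkcond [RHS]big_mkcond; apply: eq_bigr => i _.
case: ifP => [/andP[Ai p_i]|bad].
  by rewrite Ai IH ?(ltnW sT) //; exact: between_add_cell.
case: ifP => // Ai; rewrite Ai /= in bad.
by rewrite -Es Phi_zero ?bad.
Qed.

End Growth.

(** * Standard tableaux as fillings *)

(** Bijections between tableaux and fillings are given cell by cell. *)
Lemma ncard_encoding (D : {fset nat * nat}) (S : set (tableau D)) (T : nat)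
    (B : {set {ffun D -> 'I_T.+1}}) (phi psi : D -> nat -> nat) :
  (forall L, S L -> [/\ forall x, phi x (L x) <= T,
                        forall x, psi x (phi x (L x)) = L x &
                        [ffun x => inord (phi x (L x))] \in B]) ->
  (forall F, F \in B -> S [ffun x => psi x (F x)] /\
                        forall x, phi x (psi x (F x)) = F x) ->
  ncard S = #|B|.
Proof.
move=> enc dec.
pose f (F : {ffun D -> 'I_T.+1}) : tableau D := [ffun x => psi x (F x)].
have ES : S = [set f F | F in [set` B]]%classic.
  apply/seteqP; split => [L SL|_ [F /= FB <-]]; last by case: (dec F FB).
  have [phiT phiK LB] := enc L SL.
  exists [ffun x => inord (phi x (L x))] => //.
  by apply/ffunP => x; rewrite !ffunE inordK ?phiK // ltnS.
have f_inj : {in B &, injective f}.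
  move=> F G FB GB FG; apply/ffunP => x; apply/val_inj => /=.
  have [_ FK] := dec F FB; have [_ GK] := dec G GB.
  have := congr1 (fun H : {ffun _ -> _} => H x) FG; rewrite !ffunE => E.
  by rewrite -FK -GK E.
have S_fin : finite_set S.
  by rewrite ES; apply: finite_image; exact: finite_finset.
rewrite /ncard; have -> : fset_set S = [fset f F | F in B]%fset.
  apply/fsetP => L; rewrite in_fset_set //; apply/idP/imfsetP => /=.
    by rewrite ES => /set_mem[F /= FB <-]; exists F.
  by move=> [F FB ->]; rewrite ES; apply/mem_set; exists F.
by rewrite card_in_imfset //= cardE.
Qed.

Section SkewCells.
Variables (la mu : seq nat).
Local Notation D := (skew_shape la mu).

Lemma cell_bounds (x : D) : (0 < (val x).1) &&
  (nth 0 mu (val x).1.-1 < (val x).2 <= nth 0 la (val x).1.-1).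
Proof. by rewrite -mem_skew_shape; exact: valP. Qed.

(** Rows and columns of a skew shape have no gaps, so relations between
neighbours propagate. *)
Lemma row_chain (r : D -> D -> Prop) :
  (forall x y z, r x y -> r y z -> r x z) ->
  (forall x y, val y = ((val x).1, (val x).2.+1) -> r x y) ->
  forall x y, (val x).1 = (val y).1 -> (val x).2 < (val y).2 -> r x y.
Proof.
move=> r_trans r_adj x y; move Ek: ((val y).2 - (val x).2.+1) => k.
elim: k x y Ek => [|k IH] x y Ek xy1 xy2.
  apply: r_adj; rewrite xy1; case: (val y) (val x) xy2 Ek => [a b] [c d] /=.
  by move=> db bd; congr pair; lia.
have zD : ((val y).1, (val y).2.-1) \in D.
  rewrite mem_skew_shape; move: xy1 (cell_bounds x) (cell_bounds y) xy2 Ek.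
  by case: (val x) (val y) => [a b] [a' b'] /= -> *; lia.
apply: (r_trans _ [` zD]%fset).
  by apply: IH; rewrite /= in xy1 xy2 Ek *; lia.
by apply: r_adj; move: xy2 => /=; case: (fsval y) => a b /= db; congr pair; lia.
Qed.

Hypotheses (la_part : is_partition la) (mu_part : is_partition mu).

Lemma col_chain (r : D -> D -> Prop) :
  (forall x y z, r x y -> r y z -> r x z) ->
  (forall x y, val y = ((val x).1.+1, (val x).2) -> r x y) ->
  forall x y, (val x).2 = (val y).2 -> (val x).1 < (val y).1 -> r x y.
Proof.
move=> r_trans r_adj x y; move Ek: ((val y).1 - (val x).1.+1) => k.
elim: k x y Ek => [|k IH] x y Ek xy2 xy1.
  apply: r_adj; rewrite xy2; case: (val y) (val x) xy1 Ek => [a b] [c d] /=.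
  by move=> db bd; congr pair; lia.
have zD : ((val y).1.-1, (val y).2) \in D.
  rewrite mem_skew_shape; move: xy2 (cell_bounds x) (cell_bounds y) xy1 Ek.
  case: (val x) (val y) => [a b] [a' b'] /= -> x_bd y_bd aa' Ek.
  have aa'1 : a.-1 <= a'.-2 by lia.
  have := partition_nth_le mu_part aa'1.
  by have := partition_nth_le la_part (leq_pred a'.-1); lia.
apply: (r_trans _ [` zD]%fset).
  by apply: IH; rewrite /= in xy1 xy2 Ek *; lia.
by apply: r_adj; move: xy1 => /=; case: (fsval y) => a b /= db; congr pair; lia.
Qed.

Hypothesis mu_sub : forall i, nth 0 mu i <= nth 0 la i.

Lemma between_inner : between la mu (nth 0 mu).
Proof.
split=> i; first exact: partition_nth_anti.
by rewrite leqnn mu_sub.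
Qed.

Lemma inside_inner : inside la mu (nth 0 mu) = finset.set0.
Proof.
apply/setP => x; rewrite !inE; have := cell_bounds x.
by case/andP => _ /andP[]; rewrite ltnNge => /negbTE.
Qed.

(** The bijection is v |-> N - v: entries decrease from N to 1 while times
increase from 0 to N - 1.  Surjectivity onto an interval of the size of the
shape is the same as injectivity into it. *)
Lemma ncard_SYT :
  ncard (SYT D) =
  #|fillings (@adjacent la mu) (fun _ _ => true) #|` D| 0
      (inside la mu (nth 0 mu))|.
Proof.
set N := #|` D|; pose c (x : D) v := N - v.
rewrite inside_inner; apply: (@ncard_encoding _ _ _ _ c c).
  move=> L [L_surj L_row L_col].
  have P (k : 'I_N) : exists x : D, L x = k.+1.
    by case: (L_surj k.+1) => [|x [Lx _]]; [exact: ltn_ord | exists x].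
  have [f fP] := boolp.choice P.
  have f_inj : injective f.
    by move=> k l fkl; apply/val_inj; move: (fP k); rewrite fkl fP => -[].
  have f_surj x : exists k, x = f k.
    have cardle : #|{: D}| <= #|{: 'I_N}| by rewrite card_ord /N cardfE.
    by have /codomP[k ->] := inj_card_onto f_inj cardle x; exists k.
  have L_bd x : 0 < L x <= N by have [k ->] := f_surj x; rewrite fP ltn_ord.
  have L_inj x y : L x = L y -> x = y.
    have [k ->] := f_surj x; have [l ->] := f_surj y.
    by rewrite !fP => -[/val_inj ->].
  have cT x : c x (L x) <= N by exact: leq_subr.
  split=> // [x|]; first by rewrite /c subKn //; case/andP: (L_bd x).
  have FE x : nat_of_ord (inord (c x (L x)) : 'I_N.+1) = N - L x.
    by rewrite inordK // ltnS.
  apply/fillingsP; split=> [x|x _|x y _ _|x y _ _].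
  - by rewrite finset.inE.
  - by rewrite ffunE FE /=; have := L_bd x; lia.
  - rewrite !ffunE => /(congr1 val); rewrite /= !FE => E; apply: L_inj.
    by have := L_bd x; have := L_bd y; lia.
  - rewrite !ffunE !FE => /orP[] /eqP Exy.
      have : L y < L x by apply: L_row; rewrite Exy.
      by have := L_bd x; lia.
    have : L y < L x by apply: L_col; rewrite Exy.
    by have := L_bd x; lia.
move=> F /fillingsP[_ F_bd F_inj F_adj].
have F_lt x : F x < N by have := F_bd x; rewrite !finset.inE /= => /(_ isT); lia.
have F_inj' x y : F x = F y -> x = y by apply: F_inj; rewrite finset.inE.
have F_adj' x y : adjacent x y -> F x < F y by apply: F_adj; rewrite finset.inE.
split; last by move=> x; rewrite /c subKn // ltnW.
split=> [k k_bd|x y xy1 xy2|x y xy1 xy2]; rewrite ?ffunE /c.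
- pose g x := Ordinal (F_lt x).
  have g_inj : injective g.
    by move=> x y /(congr1 val) /= E; apply: F_inj'; exact: val_inj.
  have kN : N - k < N by lia.
  have cardle : #|{: 'I_N}| <= #|{: D}| by rewrite card_ord /N cardfE.
  have /codomP[x gx] := inj_card_onto g_inj cardle (Ordinal kN).
  have Fx : N - k = F x by have := congr1 val gx.
  exists x; split; first by rewrite ffunE -Fx; lia.
  move=> y; rewrite ffunE => Fy; apply: F_inj'; apply: val_inj => /=.
  by rewrite -Fx -Fy subKn // ltnW.
- have : F x < F y.
    apply: (row_chain (r := fun x y => F x < F y)) xy1 xy2 => [a b d|a b ab].
      exact: ltn_trans.
    by apply: F_adj'; rewrite /adjacent ab eqxx.
  by have := F_lt y; lia.
- have : F x < F y.
    apply: (col_chain (r := fun x y => F x < F y)) xy1 xy2 => [a b d|a b ab].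
      exact: ltn_trans.
    by apply: F_adj'; rewrite /adjacent ab eqxx orbT.
  by have := F_lt y; lia.
Qed.

End SkewCells.

(** * Lecture hall tableaux as fillings *)

(** [a] stands for n + c(x).  Ratios decrease along the tableau whereas times
increase, hence the complements of the quotient and of the remainder.  Because
the remainder is complemented relatively to [a] itself, the changing
denominator shifts the time by the amount that makes [lh_ratio_time] exact. *)
Definition lh_time (m M a L : nat) : nat :=
  (m.-1 - L %/ a) * M + (a.-1 - L %% a).

Definition lh_entry (m M a t : nat) : nat :=
  (m.-1 - t %/ M) * a + (a.-1 - t %% M).

Lemma lh_entryK (m M a L : nat) :
  0 < a <= M -> L < m * a -> lh_entry m M a (lh_time m M a L) = L.
Proof.
move=> /andP[a0 aM] L_lt; rewrite /lh_entry /lh_time.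
have v_lt : L %/ a < m by rewrite ltn_divLR.
have r_lt := ltn_pmod L a0.
have r_lt' : a.-1 - L %% a < M by lia.
rewrite divnMDl ?modnMDl ?(divn_small r_lt') ?(modn_small r_lt'); last by lia.
rewrite addn0 [RHS](divn_eq L a).
by rewrite !subKn // -ltnS prednK //; exact: leq_ltn_trans v_lt.
Qed.

Lemma lh_timeK (m M a t : nat) :
  0 < a <= M -> t < m * M -> t %% M < a -> lh_time m M a (lh_entry m M a t) = t.
Proof.
move=> /andP[a0 aM] t_lt r_lt; rewrite /lh_entry /lh_time.
have M0 : 0 < M by lia.
have v_lt : t %/ M < m by rewrite ltn_divLR.
have r_lt' : a.-1 - t %% M < a by lia.
rewrite divnMDl ?modnMDl ?(divn_small r_lt') ?(modn_small r_lt') //.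
rewrite addn0 [RHS](divn_eq t M).
by rewrite !subKn // -ltnS prednK //; exact: leq_ltn_trans v_lt.
Qed.

Lemma lh_time_lt (m M a L : nat) :
  0 < a <= M -> L < m * a -> lh_time m M a L < m * M.
Proof.
move=> /andP[a0 aM] L_lt; rewrite /lh_time.
have v_lt : L %/ a < m by rewrite ltn_divLR.
move: (L %/ a) (L %% a) (ltn_pmod L a0) v_lt => v r r_lt v_lt {L L_lt}.
apply: (@leq_trans ((m.-1 - v).+1 * M)).
  by rewrite mulSn addnC ltn_add2r; lia.
by rewrite leq_mul2r; apply/orP; right; lia.
Qed.

Lemma lh_entry_lt (m M a t : nat) :
  0 < a -> 0 < m -> lh_entry m M a t < m * a.
Proof.
move=> a0 m0; rewrite /lh_entry.
move: (t %/ M) (t %% M) => b e.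
apply: (@leq_trans ((m.-1 - b).+1 * a)).
  by rewrite mulSn addnC ltn_add2r; lia.
by rewrite leq_mul2r; apply/orP; right; lia.
Qed.

Lemma ltn_lex (M v e v' e' : nat) : e < M -> e' < M ->
  (v * M + e < v' * M + e') = (v < v') || ((v == v') && (e < e')).
Proof.
move=> eM e'M; case: (ltngtP v v') => [vv'|vv'|->] /=.
- apply: (@leq_trans (v.+1 * M)); first by rewrite mulSn addnC ltn_add2r.
  by apply: leq_trans (leq_addr _ _); rewrite leq_mul2r vv' orbT.
- apply/negbTE; rewrite -leqNgt; apply: (@leq_trans (v'.+1 * M)).
    by rewrite mulSn addnC leq_add2r ltnW.
  by apply: leq_trans (leq_addr _ _); rewrite leq_mul2r vv' orbT.
- by rewrite ltn_add2l.
Qed.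

(** This single equivalence serves both directions: read positively, with [L']
to the right of [L], it is the weak inequality along a row; negated, with [L]
below [L'], it is the strict inequality down a column. *)
Lemma lh_ratio_time (m M a L L' : nat) :
  0 < a < M -> L < m * a -> L' < m * a.+1 ->
  (L' * a <= L * a.+1) = (lh_time m M a L < lh_time m M a.+1 L').
Proof.
move=> /andP[a0 aM] L_lt L'_lt; rewrite /lh_time ltn_lex; try lia.
have v_lt : L %/ a < m by rewrite ltn_divLR.
have v'_lt : L' %/ a.+1 < m by rewrite ltn_divLR.
have r_lt := ltn_pmod L a0; have r'_lt := ltn_pmod L' (ltn0Sn a).
rewrite [in LHS](divn_eq L a) [in LHS](divn_eq L' a.+1).
move: (L %/ a) (L %% a) (L' %/ a.+1) (L' %% a.+1) v_lt v'_lt r_lt r'_lt.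
move=> v r v' r' vm v'm ra r'a {L L' L_lt L'_lt aM M}.
have -> : (m.-1 - v < m.-1 - v') = (v' < v) by lia.
have -> : (m.-1 - v == m.-1 - v') = (v == v') by lia.
have -> : (a.-1 - r < a - r') = (r' <= r) by lia.
case: (ltngtP v' v) => [vv|vv|->] /=.
- nia.
- nia.
- nia.
Qed.

(** The last digit of a time, in base [n], is the row of the cell; it makes the
times of a row-strict, column-weak filling distinct and increasing in both
directions. *)
Definition lh_time_ok (n M tau : nat) (x : nat * nat) : bool :=
  (tau %% n == x.1.-1) && ((tau %/ n) %% M < n + x.2 - x.1).

Section LectureHall.
Variables (n : nat) (la mu : seq nat).
Hypothesis la_len : size la <= n.
Local Notation D := (skew_shape la mu).

Definition denom (x : D) : nat := n + (val x).2 - (val x).1.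

Lemma row_bounds (x : D) : 0 < (val x).1 /\ (val x).1 <= n.
Proof.
have /andP[x1 /andP[_ x2]] := cell_bounds x; split=> //.
rewrite leqNgt; apply/negP => n_x.
by have := cell_bounds x; rewrite [nth 0 la _]nth_default; lia.
Qed.

Lemma denom_gt0 (x : D) : 0 < denom x.
Proof. by have := row_bounds x; have := cell_bounds x; rewrite /denom; lia. Qed.

Lemma denomE (x : D) : (n%:Z + content (val x) = (denom x)%:Z)%R.
Proof.
by have := row_bounds x; rewrite /content /denom; case: (val x) => i j /=; lia.
Qed.

Lemma lh_ratioE (L : tableau D) (x : D) :
  lh_ratio n L x = ((L x)%:R / (denom x)%:R)%R.
Proof. by rewrite /lh_ratio denomE. Qed.

Lemma lh_ratio_le (L : tableau D) (x y : D) :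
  (lh_ratio n L y <= lh_ratio n L x)%R = (L y * denom x <= L x * denom y).
Proof.
have x0 := denom_gt0 x; have y0 := denom_gt0 y.
rewrite !lh_ratioE ler_pdivrMr ?ltr0n // mulrAC ler_pdivlMr ?ltr0n //.
by rewrite -!natrM ler_nat.
Qed.

Lemma denom_row (x y : D) :
  val y = ((val x).1, (val x).2.+1) -> denom y = (denom x).+1.
Proof. by move=> Ey; have := row_bounds x; rewrite /denom Ey /=; lia. Qed.

Lemma denom_col (x y : D) :
  val y = ((val x).1.+1, (val x).2) -> denom x = (denom y).+1.
Proof. by move=> Ey; have := row_bounds y; rewrite /denom Ey /=; lia. Qed.

Lemma LHT_nat (m : nat) (L : tableau D) :
  LHT n m D L <->
  [/\ forall x, L x < m * denom x,
      forall x y : D, val y = ((val x).1, (val x).2.+1) ->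
        L y * denom x <= L x * (denom x).+1 &
      forall x y : D, val y = ((val x).1.+1, (val x).2) ->
        L y * (denom y).+1 < L x * denom y].
Proof.
have floorE x : (floor_tableau n L x < m%:Z)%R = (L x < m * denom x).
  rewrite /floor_tableau floor_lt_int lh_ratioE ltr_pdivrMr ?ltr0n ?denom_gt0 //.
  by rewrite -[(m%:Z)%:~R%R]/(m%:R)%R -natrM ltr_nat.
split=> [[[Lrow Lcol] Lm]|[Lm Lrow Lcol]]; split.
- by move=> x; rewrite -floorE.
- by move=> x y Exy; rewrite -(denom_row Exy) -lh_ratio_le; exact: Lrow.
- move=> x y Exy; rewrite -(denom_col Exy) ltnNge -lh_ratio_le -ltNge.
  exact: Lcol.
- split=> x y Exy; first by rewrite lh_ratio_le (denom_row Exy); exact: Lrow.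
  by rewrite ltNge lh_ratio_le (denom_col Exy) -ltnNge; exact: Lcol.
- by move=> x; rewrite floorE.
Qed.

Lemma ncard_LHT (m M : nat) :
  (forall x : D, denom x < M) -> (forall i, nth 0 mu i <= nth 0 la i) ->
  ncard (LHT n m D) =
  #|fillings (@adjacent la mu) (fun t x => lh_time_ok n M t (val x))
      (m * M * n) 0 (inside la mu (nth 0 mu))|.
Proof.
move=> denom_lt mu_sub; rewrite inside_inner.
set T := m * M * n.
pose phi x L := lh_time m M (denom x) L * n + (val x).1.-1.
pose psi x t := lh_entry m M (denom x) (t %/ n).
have denom_M x : 0 < denom x <= M by rewrite denom_gt0 ltnW.
have row_n (x : D) : (val x).1.-1 < n by have := row_bounds x; lia.
have n_gt0 (x : D) : 0 < n by have := row_bounds x; lia.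
apply: (@ncard_encoding _ _ _ _ phi psi).
  move=> L /LHT_nat[L_lt L_row L_col].
  have t_lt x := lh_time_lt (denom_M x) (L_lt x).
  have phi_lt x : phi x (L x) < T.
    apply: (@leq_trans ((lh_time m M (denom x) (L x)).+1 * n)).
      by rewrite /phi mulSn addnC ltn_add2r.
    by rewrite leq_mul2r t_lt orbT.
  have phi_div x : phi x (L x) %/ n = lh_time m M (denom x) (L x).
    by rewrite /phi divnMDl ?(n_gt0 x) // divn_small ?addn0.
  have phi_mod x : phi x (L x) %% n = (val x).1.-1.
    by rewrite /phi modnMDl modn_small.
  have t_row x y : val y = ((val x).1, (val x).2.+1) ->
      lh_time m M (denom x) (L x) < lh_time m M (denom y) (L y).
    move=> Exy; rewrite (denom_row Exy) -lh_ratio_time ?L_row //.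
      by rewrite denom_gt0 denom_lt.
    by rewrite -(denom_row Exy).
  have phi_row x y : val y = ((val x).1, (val x).2.+1) ->
      phi x (L x) < phi y (L y).
    move=> Exy; rewrite /phi Exy /= ltn_add2r ltn_mul2r (n_gt0 x) /=.
    exact: t_row.
  have FE x : nat_of_ord (inord (phi x (L x)) : 'I_T.+1) = phi x (L x).
    by rewrite inordK // ltnS ltnW.
  split=> [x|x|]; first exact: ltnW.
    by rewrite /psi phi_div lh_entryK.
  apply/fillingsP; split=> [x|x _|x y _ _|x y _ _].
  - by rewrite finset.inE.
  - rewrite ffunE FE phi_lt /= /lh_time_ok phi_div phi_mod eqxx /=.
    rewrite /lh_time modnMDl modn_small.
      by apply: leq_ltn_trans (leq_subr _ _) _; rewrite prednK ?denom_gt0.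
    apply: leq_ltn_trans (leq_subr _ _) _.
    exact: leq_ltn_trans (leq_pred _) (denom_lt x).
  - rewrite !ffunE => /(congr1 val); rewrite /= !FE => E; apply/val_inj.
    have E1 : (val x).1 = (val y).1.
      have [x0 _] := row_bounds x; have [y0 _] := row_bounds y.
      by rewrite -(prednK x0) -(prednK y0) -!phi_mod E.
    have chain := row_chain (r := fun x y => phi x (L x) < phi y (L y))
      (fun _ _ _ => @ltn_trans _ _ _) phi_row.
    case: (ltngtP (val x).2 (val y).2) => [lt_xy|lt_yx|E2].
    + by have := chain _ _ E1 lt_xy; rewrite E ltnn.
    + by have := chain _ _ (esym E1) lt_yx; rewrite E ltnn.
    + by apply: injective_projections.
  - rewrite !ffunE !FE => /orP[] /eqP Exy; first exact: phi_row.
    rewrite /phi Exy /=; have := row_bounds x => -[x0 _].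
    suff : lh_time m M (denom x) (L x) <= lh_time m M (denom y) (L y).
      by move=> t_xy; rewrite -addnS prednK // leq_add2r leq_mul2r t_xy orbT.
    rewrite leqNgt (denom_col Exy) -lh_ratio_time -?ltnNge ?L_col //.
      by rewrite denom_gt0 denom_lt.
    by rewrite -(denom_col Exy).
move=> F /fillingsP[_ F_bd _ F_adj].
have F_lt x : F x < T.
  by have := F_bd x; rewrite finset.inE => /(_ isT)/andP[/andP[]].
have t_lt x : F x %/ n < m * M by rewrite ltn_divLR ?(n_gt0 x).
have m_gt0 (x : D) : 0 < m by have := t_lt x; case: (m).
have [F_mod F_ok] : (forall x, F x %% n = (val x).1.-1) /\
    (forall x, (F x %/ n) %% M < denom x).
  by split=> x; have := F_bd x; rewrite finset.inE => /(_ isT)/andP[_ /andP[/eqP]].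
have tK x : lh_time m M (denom x) (psi x (F x)) = F x %/ n.
  by rewrite /psi lh_timeK.
have L_lt x : psi x (F x) < m * denom x.
  by apply: lh_entry_lt; rewrite ?denom_gt0 // (m_gt0 x).
have F_adj' x y : adjacent x y -> F x < F y by apply: F_adj; rewrite finset.inE.
split; last first.
  by move=> x; rewrite /phi tK -F_mod -divn_eq.
apply/LHT_nat; split=> [x|x y Exy|x y Exy]; rewrite !ffunE //.
- have a_bd : 0 < denom x < M by rewrite denom_gt0 denom_lt.
  have Ly : psi y (F y) < m * (denom x).+1 by rewrite -(denom_row Exy).
  rewrite (lh_ratio_time a_bd (L_lt x) Ly) -(denom_row Exy) !tK.
  have : F x < F y by apply: F_adj'; rewrite /adjacent Exy eqxx.
  rewrite {1}(divn_eq (F x) n) {1}(divn_eq (F y) n) !F_mod Exy /= ltn_add2r.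
  by rewrite ltn_mul2r (n_gt0 x).
- have a_bd : 0 < denom y < M by rewrite denom_gt0 denom_lt.
  have Lx : psi x (F x) < m * (denom y).+1 by rewrite -(denom_col Exy).
  rewrite ltnNge (lh_ratio_time a_bd (L_lt y) Lx) -(denom_col Exy) !tK -leqNgt.
  by apply: leq_div2r; apply/ltnW/F_adj'; rewrite /adjacent Exy eqxx orbT.
Qed.

End LectureHall.

Local Open Scope fset_scope.
Local Open Scope ring_scope.

(** * Determinants attached to a growing partition *)

(** The first k + 1 rows are supported on k columns, so by the pigeonhole
principle every term of the Leibniz formula has a zero factor. *)
Lemma det_zero_block (R : comNzRingType) (n : nat) (B : 'M[R]_n) (k : 'I_n) :
  (forall i j : 'I_n, (i <= k)%N -> (k <= j)%N -> B i j = 0) -> \det B = 0.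
Proof.
move=> B0; apply: big1 => s _.
suff [i ik ki] : exists2 i : 'I_n, (i <= k)%N & (k <= s i)%N.
  by rewrite (bigD1 i) //= B0 // mul0r mulr0.
pose U := [set i : 'I_n | (i <= k)%N]; pose V := [set j : 'I_n | (j < k)%N].
apply/exists_inP; apply: contraT; rewrite negb_exists_in => /forall_inP sk.
have sUV : s @: U \subset V.
  apply/subsetP => _ /imsetP[i iU ->]; rewrite !inE in iU *.
  by rewrite ltnNge; exact: sk.
have : (#|U| <= #|V|)%N.
  by rewrite -(card_imset U (@perm_inj _ s)) subset_leq_card.
have -> : U = k |: V.
  by apply/setP => i; rewrite !inE leq_eqVlt -val_eqE.
by rewrite cardsU1 inE ltnn add1n ltnn.
Qed.

Section Grid.
Variables (n : nat) (lam : nat -> nat).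

(** Strictly decreasing coordinates of a partition with [n] parts: p_i + n - i
with rows numbered from 1. *)
Definition shifted (p : nat -> nat) (i : nat) : nat := (p i + (n - i.+1))%N.

(** Rows are indexed by the growing partition, since it is a row that changes
when a cell is added; the entry function may depend on the row because the
rows are not all treated at the same time. *)
Definition grid (v : nat -> nat -> nat -> rat) (p : nat -> nat) : 'M[rat]_n :=
  \matrix_(j, i) v j (shifted lam i) (shifted p j).

Lemma shifted_add_cell (p : nat -> nat) (i j : nat) :
  shifted (add_cell p i) j = (shifted p j + (j == i))%N.
Proof. by rewrite /shifted /add_cell addnAC. Qed.

Lemma shifted_anti (p : nat -> nat) (i j : nat) :
  (forall i, p i.+1 <= p i)%N -> (i < j < n)%N -> (shifted p j < shifted p i)%N.
Proof.
move=> p_anti /andP[ij jn].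
have : (p j <= p i)%N.
  elim: j ij {jn} => // j IH; rewrite ltnS leq_eqVlt => /orP[/eqP ->//|/IH].
  exact: leq_trans.
rewrite /shifted; lia.
Qed.

Lemma shifted_leq (p : nat -> nat) (i j : nat) :
  (forall i, p i.+1 <= p i)%N -> (i <= j < n)%N ->
  (shifted p j <= shifted p i)%N.
Proof.
move=> p_anti /andP[]; rewrite leq_eqVlt => /orP[/eqP -> //|ij] jn.
by apply/ltnW/shifted_anti; rewrite ?ij.
Qed.

Hypothesis lam_anti : forall i, (lam i.+1 <= lam i)%N.

(** An entry in position (j, i) can be nonzero only if l_i = q_j <= l_j, which
forces j <= i: the matrix is triangular. *)
Lemma det_grid_delta (p : nat -> nat) :
  (forall i, p i <= lam i)%N ->
  \det (grid (fun _ l q => (l == q)%:R) p) = [forall i : 'I_n, p i == lam i]%:R.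
Proof.
move=> p_lam; rewrite -det_tr det_trig; last first.
  apply/is_trig_mxP => i j ij; rewrite !mxE.
  have lt_ij : (shifted lam j < shifted lam i)%N.
    by apply: shifted_anti => //; rewrite ij ltn_ord.
  have := p_lam j; case: eqP => // E; move: lt_ij; rewrite E /shifted; lia.
case: forallP => [p_eq|p_neq].
  by rewrite big1 // => i _; rewrite !mxE /shifted (eqP (p_eq i)) eqxx.
apply/eqP; rewrite prodf_seq_eq0; apply/hasP.
have /forallP : ~~ [forall i : 'I_n, p i == lam i] by apply/forallP.
move/forallP; rewrite negb_forall => /existsP[i p_i].
exists i; first by rewrite mem_index_enum.
by rewrite /= !mxE /shifted eqn_add2r [lam i == _]eq_sym (negbTE p_i).
Qed.

(** If row [i] of the partition is already full, the rows up to [i] of the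
matrix vanish in the columns from [i] on.  If row [i] is as long as the row above, the new rows [i.-1] and
[i] coincide. *)
Lemma det_grid_not_addable (v : nat -> nat -> nat -> rat) (p : nat -> nat)
    (i : 'I_n) :
  (forall i, p i.+1 <= p i)%N -> (forall i, p i <= lam i)%N ->
  (forall j l q, (l < q)%N -> v j l q = 0) ->
  ((0 < i)%N -> v i.-1 = v i) ->
  ~~ ((p i < lam i)%N && ((nat_of_ord i == 0%N) || (p i < p i.-1)%N)) ->
  \det (grid v (add_cell p i)) = 0.
Proof.
move=> p_anti p_lam v0 vi; rewrite negb_and -leqNgt => /orP[lam_p|].
  apply: (@det_zero_block _ _ _ i) => j k ji ik; rewrite mxE v0 //.
  have := shifted_leq lam_anti (_ : i <= k < n)%N; rewrite ik ltn_ord => /(_ isT).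
  rewrite shifted_add_cell; case: (eqVneq (j : nat) i) => [->|ji'] /=.
    rewrite /shifted; lia.
  have := shifted_anti p_anti (_ : j < i < n)%N.
  rewrite ltn_ord ltn_neqAle ji' ji => /(_ isT); rewrite /shifted; lia.
rewrite negb_or -leqNgt -lt0n => /andP[i_gt0 p_p].
have i'n : (i.-1 < n)%N by apply: leq_ltn_trans (leq_pred _) (ltn_ord i).
apply: (@determinant_alternate _ _ _ (Ordinal i'n) i).
  by rewrite -val_eqE /=; lia.
move=> k; rewrite !mxE /= vi // !shifted_add_cell eqxx; congr v.
have := p_anti i.-1; rewrite prednK // /shifted; have := ltn_ord i; lia.
Qed.

Lemma det_grid_row_split (v w : nat -> nat -> nat -> rat) (p : nat -> nat)
    (i : 'I_n) (c : rat) :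
  (forall j l q, (j != i)%N -> v j l q = w j l q) ->
  (forall l, v i l (shifted p i) =
     w i l (shifted p i) + c * w i l (shifted p i).+1) ->
  \det (grid v p) = \det (grid w p) + c * \det (grid w (add_cell p i)).
Proof.
move=> vw vi; rewrite -[X in X + _]mul1r.
apply: (@determinant_multilinear _ _ _ _ _ i).
- apply/rowP => k; rewrite !mxE vi shifted_add_cell eqxx addn1; ring.
- apply/matrixP => j k; rewrite !mxE vw //; by rewrite eq_sym neq_lift.
- apply/matrixP => j k; rewrite !mxE vw; last by rewrite eq_sym neq_lift.
  have ji : (lift i j == i :> nat) = false.
    by apply/negbTE; rewrite val_eqE eq_sym neq_lift.
  by rewrite shifted_add_cell ji addn0.
Qed.

End Grid.

(** * The number of standard tableaux *)

(** The inverse factorial of l - q, with its natural value 0 at negative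
integers. *)
Definition invfact (l q : nat) : rat :=
  if (q <= l)%N then ((l - q)`!)%:R^-1 else 0.

Lemma invfactS (l q : nat) : invfact l q.+1 = (l%:R - q%:R) * invfact l q.
Proof.
rewrite /invfact; case: (ltngtP q l) => [q_l|l_q|->]; last 2 first.
- by rewrite mulr0.
- by rewrite subrr mul0r.
rewrite -(subnSK q_l) factS natrM invfM mulrA.
have -> : l%:R - q%:R = (l - q.+1).+1%:R :> rat.
  by rewrite subnSK // natrB // ltnW.
by rewrite divff ?mul1r // pnatr_eq0.
Qed.

Definition invfact_det (n : nat) (lam p : nat -> nat) : rat :=
  \det (grid n lam (fun _ => invfact) p).

Definition num_left (n : nat) (lam p : nat -> nat) : nat :=
  (\sum_(i < n) (lam i - p i))%N.

(** In each term of the Leibniz formula, raising q_i multiplies by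
l_(s i) - q_i, and these factors add up to the sum of all the l_i - q_i for
every permutation s. *)
Lemma invfact_det_sum (n : nat) (lam p : nat -> nat) :
  (forall i, p i <= lam i)%N ->
  \sum_(i < n) invfact_det n lam (add_cell p i) =
  (num_left n lam p)%:R * invfact_det n lam p.
Proof.
move=> p_lam; rewrite /invfact_det /determinant exchange_big mulr_sumr /=.
apply: eq_bigr => s _; rewrite -mulr_sumr [RHS]mulrCA; congr (_ * _).
transitivity (\sum_(i < n) ((shifted n lam (s i))%:R - (shifted n p i)%:R) *
                \prod_(j < n) grid n lam (fun _ => invfact) p j (s j)).
  apply: eq_bigr => i _; rewrite (bigD1 i) //= [in RHS](bigD1 i) //= mulrA.
  rewrite !mxE shifted_add_cell eqxx addn1 invfactS; congr (_ * _).
  apply: eq_bigr => j ji; rewrite !mxE shifted_add_cell.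
  by rewrite (_ : (j == i :> nat) = false) ?addn0 //; exact: negbTE.
rewrite -mulr_suml; congr (_ * _).
rewrite [RHS](_ : _ = \sum_(i < n) ((shifted n lam i)%:R - (shifted n p i)%:R)).
  by rewrite !sumrB [in RHS](reindex_perm s).
rewrite /num_left natr_sum; apply: eq_bigr => i _.
by rewrite natrB // /shifted !natrD; ring.
Qed.

(** The falling factorial counts the possible sets of times, multiplied by the
factorial of the number of cells; keeping [T] arbitrary makes the recursion on
time close up. *)
Theorem card_fillings_free (n : nat) (la mu : seq nat) (T tau : nat)
    (p : nat -> nat) :
  is_partition la -> (size la <= n)%N -> (tau <= T)%N -> between la mu p ->
  #|fillings (@adjacent la mu) (fun _ _ => true) T tau (inside la mu p)|%:R =
  ((T - tau) ^_ (num_left n (nth 0%N la) p))%:R *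
    invfact_det n (nth 0%N la) p.
Proof.
move=> la_part la_len; move: tau p.
have la_anti i : (nth 0 la i.+1 <= nth 0 la i)%N by exact: partition_nth_anti.
apply: (card_fillings_unique la_part la_len (A := fun _ _ => true)).
- move=> p [p_anti p_bd].
  have p_la i : (p i <= nth 0 la i)%N by case/andP: (p_bd i).
  rewrite subnn; case: forallP => [p_eq|p_neq].
    rewrite /num_left big1 => [|i _]; last by rewrite (eqP (p_eq i)) subnn.
    rewrite ffactn0 mul1r /invfact_det det_trig.
      rewrite big1 // => i _.
      by rewrite mxE /shifted (eqP (p_eq i)) /invfact leqnn subnn invr1.
    apply/is_trig_mxP => i j ij; rewrite mxE /invfact /shifted (eqP (p_eq i)).
    rewrite ifF //; apply/negbTE; rewrite -ltnNge.
    by apply: (shifted_anti (n := n)) => //; rewrite ij ltn_ord.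
  rewrite ffact_small ?mul0r //; rewrite lt0n /num_left sum_nat_eq0.
  apply/forallP => p_eq; apply: p_neq => i; have := p_eq i; have := p_la i; lia.
- move=> tau p tauT [p_anti p_bd].
  have p_la i : (p i <= nth 0 la i)%N by case/andP: (p_bd i).
  set N := num_left _ _ p.
  transitivity (((T - tau.+1) ^_ N)%:R * invfact_det n (nth 0%N la) p +
    ((T - tau.+1) ^_ N.-1)%:R *
      \sum_(i < n) invfact_det n (nth 0%N la) (add_cell p i)).
    rewrite invfact_det_sum // -/N mulrA -mulrDl; congr (_ * _).
    rewrite -natrM -natrD; congr (_%:R).
    rewrite -subnSK //; case: N => [|N]; first by rewrite !ffactn0.
    rewrite [in RHS]/=.
    case: (leqP N (T - tau.+1)) => [N_le|N_gt].
      rewrite ffactSS ffactnSr -mulnDr mulnC; congr muln; lia.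
    by rewrite !ffact_small //; lia.
  congr (_ + _); rewrite mulr_sumr; apply: eq_bigr => i _.
  case: (ltnP (p i) (nth 0%N la i)) => [p_i|p_i]; last first.
    have -> : invfact_det n (nth 0%N la) (add_cell p i) = 0.
      apply: det_grid_not_addable => //.
        by move=> _ l q; rewrite /invfact ltnNge => /negbTE ->.
      by rewrite negb_and -leqNgt p_i.
    by rewrite !mulr0.
  congr ((_ ^_ _)%:R * _).
  rewrite /N /num_left (bigD1 i) //= [in RHS](bigD1 i) //=.
  have -> : (\sum_(j < n | j != i) (nth 0 la j - add_cell p i j) =
             \sum_(j < n | j != i) (nth 0 la j - p j))%N.
    apply: eq_bigr => j ji; rewrite /add_cell.
    by rewrite (_ : (j == i :> nat) = false) ?addn0 //; exact: negbTE.
  rewrite /add_cell eqxx; set Z := (\sum_(_ < n | _) _)%N; clearbody Z.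
  by move: p_i; rewrite addn1; lia.
- move=> tau p i tauT [p_anti p_bd] _ bad.
  have p_la j : (p j <= nth 0 la j)%N by case/andP: (p_bd j).
  rewrite /invfact_det det_grid_not_addable ?mulr0 //.
  by move=> _ l q; rewrite /invfact ltnNge => /negbTE ->.
Qed.

(** * The number of lecture hall tableaux *)

Lemma mul_bin_trinomial (l r q : nat) :
  (q <= r <= l)%N -> ('C(l, r) * 'C(r, q) = 'C(l, q) * 'C(l - q, r - q))%N.
Proof.
move=> /andP[qr rl]; have ql := leq_trans qr rl.
have pos : (0 < q`! * ((r - q)`! * (l - r)`!))%N by rewrite !muln_gt0 !fact_gt0.
apply/eqP; rewrite -(eqn_pmul2r pos); apply/eqP.
have E1 := bin_fact rl; have E2 := bin_fact qr; have E3 := bin_fact ql.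
have rl' : (r - q <= l - q)%N by lia.
have := bin_fact rl'; rewrite (_ : l - q - (r - q) = l - r)%N; last by lia.
move=> E4; transitivity l`!.
  by rewrite -E1 -E2; ring.
by rewrite -E3 -E4; ring.
Qed.

(** Choosing [r] among [l] and then [q] among [r], against choosing [q] first:
the binomial theorem does the rest. *)
Lemma sum_bin_bin (l q b : nat) :
  (\sum_(r < l.+1) 'C(r, q) * ('C(l, r) * b ^ (l - r)) =
   'C(l, q) * b.+1 ^ (l - q))%N.
Proof.
case: (leqP q l) => [ql|lq]; last first.
  rewrite bin_small // mul0n big1 // => r _; rewrite bin_small ?mul0n //.
  exact: leq_trans lq.
rewrite -(big_mkord xpredT (fun r => 'C(r, q) * ('C(l, r) * b ^ (l - r)))%N).
rewrite (@big_cat_nat _ _ _ q) //=; last exact: ltnW.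
rewrite big_nat_cond big1 ?add0n => [|r /andP[/andP[_ rq] _]]; last first.
  by rewrite bin_small.
rewrite -{1}[q]add0n big_addn subSn // big_mkord.
rewrite -[b.+1]addn1 expnDn big_distrr /=; apply: eq_bigr => r _.
rewrite exp1n muln1 mulnA [('C(_, q) * _)%N]mulnC mul_bin_trinomial.
  by rewrite addnK -mulnA addnC subnDA.
by rewrite leq_addl /=; have := ltn_ord r; lia.
Qed.

(** The number of ways in which a single row, whose shifted length is [q],
reaches the shifted length [l] when [s] time steps remain: a step lengthens the
row or not, and may lengthen it only when the middle digit of the time is at
most [q].  That digit is [M.-1 - s' %% M] because [s'] counts backwards. *)
Fixpoint paths (M s l q : nat) : nat :=
  if s is s'.+1
  then (paths M s' l q + (M.-1 - s' %% M <= q) * paths M s' l q.+1)%N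
  else l == q.

Lemma paths_small (M s l q : nat) : (l < q)%N -> paths M s l q = 0%N.
Proof.
elim: s q => [|s IH] q lq /=; first by rewrite ltn_eqF.
by rewrite !IH ?muln0 //; exact: ltnW.
Qed.

(** The number of ways in which a row grows from [q] to [r] during the steps of
a block with digits d, ..., M - 1, for r < M.  A row with q < d can no longer
grow; any other row ends at length r if it grows at r - q of the digits
d, ..., r - 1 and not at the digit r. *)
Definition block_paths (d r q : nat) : nat :=
  if (q < d)%N then (r == q : nat) else ((d <= r) * 'C(r - d, q - d))%N.

Lemma block_pathsS (d r q : nat) :
  block_paths d r q =
  (block_paths d.+1 r q + (d <= q) * block_paths d.+1 r q.+1)%N.
Proof.
rewrite /block_paths ltnS.
case: (ltngtP q d) => [qd|dq|->].
- by rewrite addn0.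
- rewrite ltnS (leq_gtF (ltnW dq)) mul1n.
  case: (ltngtP d r) => [dr|rd|dr] //; last first.
    by rewrite -dr subnn bin_small ?muln0 ?subn_gt0.
  by rewrite !mul1n subSS -(subnSK dr) -(subnSK dq) binS addnC.
- by rewrite ltnn subnn bin0 subnn bin0 !muln1 mul1n; case: ltngtP.
Qed.

(** A block that has [e] steps left is followed by [b] whole blocks; [r] is the
length of the row at the boundary.  Since r <= l < M, for e = 0 the only
nonzero term is r = q. *)
Lemma paths_block_offset (M b e l q : nat) :
  (forall q', paths M (b * M) l q' = ('C(l, q') * b ^ (l - q'))%N) ->
  (l < M)%N -> (e <= M)%N ->
  paths M (b * M + e) l q =
  (\sum_(r < l.+1) block_paths (M - e) r q * ('C(l, r) * b ^ (l - r)))%N.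
Proof.
move=> H0 lM; elim: e q => [|e IH] q eM.
  rewrite addn0 subn0 H0 /block_paths; case: (ltnP q M) => [qM|Mq]; last first.
    rewrite bin_small ?mul0n ?big1 // => [r _|]; last exact: leq_trans Mq.
    by rewrite leqNgt (leq_trans (ltn_ord r)).
  case: (ltnP q l.+1) => [ql|lq]; last first.
    rewrite bin_small // mul0n big1 // => r _.
    by rewrite ltn_eqF // (leq_trans (ltn_ord r)).
  rewrite (bigD1 (Ordinal ql)) //= eqxx mul1n big1 ?addn0 // => r.
  by rewrite -val_eqE /= => /negbTE ->.
rewrite addnS /= !IH ?(ltnW eM) // modnMDl modn_small //.
rewrite (_ : M.-1 - e = M - e.+1)%N; last by lia.
rewrite big_distrr -big_split; apply: eq_bigr => r _ /=.
rewrite [block_paths (M - e.+1) r q]block_pathsS subnSK //; ring.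
Qed.

Lemma paths_blocks (M b l q : nat) :
  (l < M)%N -> paths M (b * M) l q = ('C(l, q) * b ^ (l - q))%N.
Proof.
move=> lM; elim: b q => [|b IH] q /=.
  case: (ltngtP l q) => [lq|ql|->].
  - by rewrite bin_small.
  - by rewrite exp0n ?muln0 // subn_gt0.
  - by rewrite binn subnn.
rewrite mulSn addnC paths_block_offset // subnn -sum_bin_bin.
by apply: eq_bigr => r _; rewrite /block_paths /= !subn0 mul1n.
Qed.

Definition lh_det (n m : nat) (lam p : nat -> nat) : rat :=
  \det (grid n lam (fun _ l q => ('C(l, q) * m ^ (l - q))%:R) p).

(** The number of time steps of the form t n + j that precede [tau], that is
the number of times at which row [j] has already been treated. *)
Definition stage (n tau j : nat) : nat := ((tau + (n - j.+1)) %/ n)%N.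

Lemma stageE (n t r j : nat) : (r < n)%N -> (j < n)%N ->
  stage n (t * n + r) j = (t + (j < r))%N.
Proof.
move=> rn jn; have n0 : (0 < n)%N by lia.
rewrite /stage -addnA divnMDl //; congr addn.
case: ltnP => jr; last by rewrite divn_small //; lia.
rewrite (_ : r + (n - j.+1) = n + (r - j.+1))%N; last by lia.
by rewrite divnDl // divnn n0 divn_small //; lia.
Qed.

Lemma stageS (n t r j : nat) : (r < n)%N -> (j < n)%N ->
  stage n (t * n + r).+1 j = (t + (j <= r))%N.
Proof.
move=> rn jn; have n0 : (0 < n)%N by lia.
rewrite -addnS; case: (eqVneq r.+1 n) => [rn1|rn1].
  rewrite rn1 addnC -mulSn -[(t.+1 * n)%N]addn0 stageE //.
  by rewrite addn0 -addn1; congr addn; lia.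
by rewrite stageE; lia.
Qed.

(** Reading the middle digit of a time from the number of remaining steps. *)
Lemma modn_reflect (m M t : nat) : (t < m * M)%N ->
  (M.-1 - (m * M - t.+1) %% M = t %% M)%N.
Proof.
move=> t_lt; have M0 : (0 < M)%N by case: M t_lt => //; rewrite muln0.
have := divn_eq t M; have := ltn_pmod t M0.
have : (t %/ M < m)%N by rewrite ltn_divLR.
move: (t %/ M)%N (t %% M)%N => b r bm rM Et.
have -> : (m * M - t.+1 = (m - b.+1) * M + (M - r.+1))%N.
  rewrite mulnBl mulSn Et; have : (b * M + M <= m * M)%N.
    by rewrite addnC -mulSn leq_mul2r bm orbT.
  lia.
by rewrite modnMDl modn_small; lia.
Qed.

(** At time t n + i only row [i] of the determinant changes, by the recursion
that defines [paths].  Just after that time, row [i] and the row above it have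
been treated equally often, as [det_grid_not_addable] requires. *)
Theorem card_fillings_lh (n m M : nat) (la mu : seq nat) (p : nat -> nat) :
  is_partition la -> (size la <= n)%N ->
  (forall i, shifted n (nth 0%N la) i < M)%N -> between la mu p ->
  #|fillings (@adjacent la mu) (fun t x => lh_time_ok n M t (val x))
      (m * M * n) 0 (inside la mu p)|%:R = lh_det n m (nth 0%N la) p.
Proof.
move=> la_part la_len la_M p_bt; set T := (m * M * n)%N.
have la_anti i : (nth 0 la i.+1 <= nth 0 la i)%N by exact: partition_nth_anti.
pose v tau := fun j l q => (paths M (m * M - stage n tau j) l q)%:R : rat.
pose Phi tau p := \det (grid n (nth 0%N la) (v tau) p).
transitivity (Phi 0%N p); last first.
  rewrite /Phi /lh_det; congr (\det _); apply/matrixP => j i; rewrite !mxE /v.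
  have jn := ltn_ord j; rewrite /stage add0n divn_small; last lia.
  by rewrite subn0 paths_blocks.
apply: (card_fillings_unique la_part la_len (A := lh_time_ok n M)) => //.
- move=> {p_bt} {}p [p_anti p_bd].
  have p_la i : (p i <= nth 0 la i)%N by case/andP: (p_bd i).
  rewrite -(det_grid_delta n la_anti p_la) /Phi; congr (\det _).
  apply/matrixP => j i; rewrite !mxE /v /stage /T.
  have jn := ltn_ord j; have n0 : (0 < n)%N by lia.
  by rewrite divnMDl // divn_small ?addn0 ?subnn //; lia.
- move=> tau {p_bt} {}p tauT [p_anti p_bd].
  have n0 : (0 < n)%N by move: tauT; rewrite /T; case: (n) => //; rewrite muln0.
  pose i := Ordinal (ltn_pmod tau n0); pose t := (tau %/ n)%N.
  have t_lt : (t < m * M)%N by rewrite ltn_divLR.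
  have Etau : tau = (t * n + i)%N by exact: divn_eq.
  have vi l q : v tau i l q =
      v tau.+1 i l q + (t %% M <= q)%N%:R * v tau.+1 i l q.+1.
    rewrite /v Etau stageE ?stageS // ltnn leqnn addn0 addn1 -subnSK //=.
    by rewrite modn_reflect // natrD natrM.
  have vother (j : 'I_n) l q : j != i -> v tau j l q = v tau.+1 j l q.
    move=> ji; rewrite /v Etau stageE ?stageS //.
    congr (paths _ (_ - (_ + _)) _ _)%:R.
    by rewrite ltn_neqAle -[_ == _ :> nat]/(j == i) ji.
  rewrite /Phi (@det_grid_row_split _ _ (v tau) (v tau.+1) p i
    (t %% M <= shifted n p i)%N%:R); last 2 first.
  + by move=> j l q; exact: vother.
  + by move=> l; exact: vi.
  congr (_ + _); rewrite big_mkcond (bigD1 i) //= big1 ?addr0 => [|j ji].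
    rewrite /lh_time_ok /= eqxx -/t /=.
    rewrite (_ : (_ < _)%N = (t %% M <= shifted n p i)%N).
      by case: ifP => _; rewrite ?mul1r ?mul0r.
    by rewrite /shifted; have := ltn_ord i; rewrite /=; lia.
  by rewrite /lh_time_ok /= eq_sym -[_ == _ :> nat]/(j == i) (negbTE ji).
- move=> tau {p_bt} {}p i tauT [p_anti p_bd] /andP[/eqP Ei _] bad.
  have p_la j : (p j <= nth 0 la j)%N by case/andP: (p_bd j).
  apply: det_grid_not_addable => //.
    by move=> j l q lq; rewrite /v paths_small.
  move=> i0; rewrite /v (divn_eq tau n) Ei /=.
  have i'n : (i.-1 < n)%N by apply: leq_ltn_trans (leq_pred _) (ltn_ord i).
  by rewrite !stageS // leqnn leq_pred.
Qed.

(** In a nonzero term of the Leibniz formula the powers of [m] multiply to the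
same power for all permutations.  Working term by term, rather than scaling
rows and columns by powers of [m], covers m = 0. *)
Lemma lh_detE (n m : nat) (lam p : nat -> nat) :
  (forall i, p i <= lam i)%N ->
  lh_det n m lam p = m%:R ^+ num_left n lam p *
    (\prod_(i < n) ((shifted n lam i)`!%:R / (shifted n p i)`!%:R)) *
    invfact_det n lam p.
Proof.
move=> p_lam; rewrite /lh_det /invfact_det /determinant mulr_sumr.
apply: eq_bigr => s _; rewrite [RHS]mulrCA; congr (_ * _).
case: (boolP [forall i : 'I_n, shifted n p i <= shifted n lam (s i)]%N); last first.
  rewrite negb_forall => /existsP[i i_lt].
  rewrite (bigD1 i) //= [X in _ = _ * X](bigD1 i) //= !mxE.
  rewrite bin_small ?mul0n; last first.
    by rewrite ltnNge.
  by rewrite /invfact (negbTE i_lt) !mul0r mulr0.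
move=> /forallP s_le.
transitivity (\prod_(i < n) (m%:R ^+ (shifted n lam (s i) - shifted n p i) *
  ((shifted n lam (s i))`!%:R / (shifted n p i)`!%:R) *
  invfact (shifted n lam (s i)) (shifted n p i) : rat)).
  apply: eq_bigr => i _; rewrite mxE natrM natrX /invfact s_le.
  rewrite -(bin_fact (s_le i)) 2!natrM.
  have f0 k : k`!%:R != 0 :> rat by rewrite pnatr_eq0 -lt0n fact_gt0.
  field; rewrite !f0; exact: isT.
rewrite 2!big_split /=; congr (_ * _ * _);
  last by apply: eq_bigr => i _; rewrite !mxE.
  rewrite -expr_sum; congr (_ ^+ _).
  have E : (\sum_(i < n) (shifted n lam (s i) - shifted n p i) +
            \sum_(i < n) shifted n p i = num_left n lam p +
            \sum_(i < n) shifted n p i)%N.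
    rewrite -[LHS]big_split -[RHS]big_split /=.
    transitivity (\sum_(i < n) shifted n lam (s i))%N.
      by apply: eq_bigr => i _; rewrite subnK.
    rewrite -(reindex_inj (F := fun i : 'I_n => shifted n lam i)
      (P := xpredT) (@perm_inj _ s)).
    by apply: eq_bigr => i _; have := p_lam i; rewrite /shifted; lia.
  exact: addIn E.
rewrite !big_split /=; congr (_ * _).
by rewrite [RHS](reindex_perm s).
Qed.

(** * Sums and products over the cells of a skew shape *)
Lemma perm_skew_shape (n : nat) (la mu : seq nat) :
  (size la <= n)%N ->
  perm_eq (skew_shape la mu)
    [seq (i.+1, j.+1) | i <- iota 0 n,
                        j <- index_iota (nth 0%N mu i) (nth 0%N la i)].
Proof.
move=> la_len; apply: uniq_perm; first exact: fset_uniq.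
  apply: allpairs_uniq_dep; first exact: iota_uniq.
    by move=> i _; exact: iota_uniq.
  by move=> [i j] [i' j'] _ _ /= [-> ->].
move=> [i j]; rewrite mem_skew_shape /=; apply/idP/allpairsPdep => [|[k [l]]].
  case: i j => [|i] [|j] //=.
  move=> /andP[mu_j j_la]; exists i, j; split=> //; last first.
    by rewrite mem_index_iota -ltnS mu_j.
  rewrite mem_iota add0n; rewrite ltnNge; apply/negP => n_i.
  by rewrite nth_default // (leq_trans la_len n_i) in j_la.
by rewrite mem_index_iota => -[_ kl [-> ->]].
Qed.

Lemma big_skew_shape (R : Type) (idx : R) (op : Monoid.com_law idx)
    (n : nat) (la mu : seq nat) (f : nat * nat -> R) :
  (size la <= n)%N ->
  \big[op/idx]_(x <- skew_shape la mu) f x =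
  \big[op/idx]_(i < n)
    \big[op/idx]_(nth 0%N mu i <= j < nth 0%N la i) f (i.+1, j.+1).
Proof.
move=> la_len; rewrite (perm_big _ (perm_skew_shape mu la_len)) /=.
by rewrite big_allpairs_dep -[n in iota 0 n]subn0 big_mkord.
Qed.

Lemma card_skew_shape (n : nat) (la mu : seq nat) :
  (size la <= n)%N ->
  #|` skew_shape la mu| = num_left n (nth 0%N la) (nth 0%N mu).
Proof.
move=> la_len; rewrite /num_left -sum1_size (big_skew_shape _ _ _ la_len).
by apply: eq_bigr => i _; rewrite sum_nat_const_nat muln1.
Qed.

(** Along row i the numbers n + c(x) run from q_i + 1 to l_i. *)
Lemma prod_content (n : nat) (la mu : seq nat) :
  (size la <= n)%N -> (forall i, nth 0 mu i <= nth 0 la i)%N ->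
  \prod_(x <- skew_shape la mu) (n%:Z + content x)%:~R =
  \prod_(i < n) ((shifted n (nth 0%N la) i)`!%:R /
                 (shifted n (nth 0%N mu) i)`!%:R) :> rat.
Proof.
move=> la_len mu_la; rewrite (@big_skew_shape _ _ _ n) //.
apply: eq_bigr => i _; have i_n := ltn_ord i.
rewrite /shifted; move: (mu_la i); elim: (nth 0%N la i) => [|l IH] mu_l.
  have -> : nth 0%N mu i = 0%N by lia.
  by rewrite big_geq // divff // pnatr_eq0 -lt0n fact_gt0.
move: mu_l; rewrite leq_eqVlt => /orP[/eqP ->|mu_l].
  by rewrite big_geq // divff // pnatr_eq0 -lt0n fact_gt0.
rewrite big_nat_recr //= IH // addSn factS natrM mulrC mulrA; congr (_ * _ / _).
rewrite /content /= -[RHS]/((_.+1)%:Z%:~R); congr (_%:~R); lia.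
Qed.

Lemma nth_le_of_diagram (la mu : seq nat) :
  (diagram mu `<=` diagram la)%fset -> forall i, (nth 0 mu i <= nth 0 la i)%N.
Proof.
move=> /fsubsetP mu_la i; case E: (nth 0%N mu i) => [//|j].
have [i_mu|i_mu] := ltnP i (size mu); last by rewrite nth_default in E.
have := mu_la (i.+1, j.+1); rewrite !diagramP /part /= E i_mu leqnn.
by case/(_ isT)/andP.
Qed.

Lemma ncard_SYT_det (n : nat) (la mu : seq nat) :
  is_partition la -> is_partition mu ->
  (forall i, nth 0 mu i <= nth 0 la i)%N -> (size la <= n)%N ->
  (ncard (SYT (skew_shape la mu)))%:R =
  (#|` skew_shape la mu|)`!%:R * invfact_det n (nth 0%N la) (nth 0%N mu) :> rat.
Proof.
move=> la_part mu_part mu_sub la_len.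
rewrite ncard_SYT // (@card_fillings_free n) //; last exact: between_inner.
by rewrite subn0 -(card_skew_shape mu la_len) ffactnn.
Qed.

Theorem ncard_LHT_skew (n m : nat) (la mu : seq nat) :
  is_partition la -> is_partition mu ->
  (forall i, nth 0 mu i <= nth 0 la i)%N -> (size la <= n)%N ->
  (ncard (LHT n m (skew_shape la mu)))%:R =
    m%:R ^+ #|` skew_shape la mu| *
    ((ncard (SYT (skew_shape la mu)))%:R / (#|` skew_shape la mu|)`!%:R) *
    \prod_(x <- skew_shape la mu) (n%:Z + content x)%:~R :> rat.
Proof.
move=> la_part mu_part mu_sub la_len.
have la_le i : (nth 0 la i <= nth 0 la 0)%N by exact: partition_nth_le.
rewrite (@ncard_LHT _ _ _ la_len m (n + nth 0%N la 0).+1) //; last first.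
  move=> x; rewrite ltnS; have := la_le (val x).1.-1; have := cell_bounds x.
  by rewrite /denom; lia.
rewrite card_fillings_lh //; last 2 first.
- by move=> i; rewrite /shifted ltnS; have := la_le i; lia.
- exact: between_inner.
rewrite lh_detE // (ncard_SYT_det la_part mu_part mu_sub la_len).
rewrite (prod_content la_len mu_sub) -(card_skew_shape mu la_len).
have f0 : (#|` skew_shape la mu|)`!%:R != 0 :> rat.
  by rewrite pnatr_eq0 -lt0n fact_gt0.
by rewrite [_`!%:R * _]mulrC mulfK // mulrAC.
Qed.

(** * Straight shapes *)
Lemma diagramE (la : seq nat) : diagram la = skew_shape la [::].
Proof.
rewrite /skew_shape; have -> : diagram [::] = fset0.
  apply/fsetP => x; rewrite diagramP in_fset0 /=; lia.
by rewrite fsetD0.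
Qed.

(** When u < a and v < a + 1, comparing v / (a + 1) with u / a is comparing v
with u.  The entry bounds also agree: strict columns push the bound of the
first row down to n + c(x), and conversely the bound at the start of a row is
at most n and controls the row. *)
Lemma SSYT_LHT1 (n : nat) (la : seq nat) :
  is_partition la -> (size la <= n)%N ->
  SSYT n (diagram la) = LHT n 1 (diagram la).
Proof.
rewrite diagramE => la_part la_len.
set D := skew_shape la [::].
have row_adj (a u v : nat) : (u < a)%N -> (v < a.+1)%N ->
    (v * a <= u * a.+1)%N = (v <= u)%N.
  by move=> ua va; case: (leqP v u) => ?; [nia|apply/negbTE; nia].
have nth0 i : nth 0%N [::] i = 0%N by rewrite nth_nil.
apply/seteqP; split=> L.
  move=> [L_lt L_row L_col].
  have L_denom x : (L x < denom n x)%N.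
    have col_bd k : forall x : D, (val x).1 = k.+1 -> (L x + k < n)%N.
      elim: k => [|k IH] {}x Ex; first by rewrite addn0.
      have yD : (k.+1, (val x).2) \in D.
        rewrite mem_skew_shape; move: (cell_bounds x) Ex.
        case: (val x) => a b /=; rewrite !nth0 => + Ea; rewrite Ea /=.
        by have := partition_nth_anti k la_part; lia.
      have := IH [` yD]%fset erefl.
      have : (L x < L [` yD]%fset)%N by apply: L_col; rewrite // Ex.
      lia.
    have [x1 _] := row_bounds la_len x; have := col_bd _ x (esym (prednK x1)).
    have := cell_bounds x; rewrite /denom; lia.
  apply/(LHT_nat la_len); split=> [x|x y Exy|x y Exy].
  - by rewrite mul1n.
  - rewrite row_adj -?(denom_row la_len Exy) //.
    by apply: L_row; rewrite Exy.
  - rewrite ltnNge row_adj -?(denom_col la_len Exy) // -ltnNge.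
    by apply: L_col; rewrite Exy.
move=> /(LHT_nat la_len)[L_lt L_row L_col].
have L_denom x : (L x < denom n x)%N by have := L_lt x; rewrite mul1n.
have row x y : val y = ((val x).1, (val x).2.+1) -> (L y <= L x)%N.
  move=> Exy; rewrite -(row_adj (denom n x)) ?L_row //.
  by rewrite -(denom_row la_len Exy).
have col x y : val y = ((val x).1.+1, (val x).2) -> (L y < L x)%N.
  move=> Exy; rewrite ltnNge -(row_adj (denom n y)) -?ltnNge ?L_col //.
  by rewrite -(denom_col la_len Exy).
have rows := row_chain (r := fun x y => (L y <= L x)%N)
  (fun _ _ _ yx zy => leq_trans zy yx) row.
have cols := col_chain la_part (isT : is_partition [::])
  (r := fun x y => (L y < L x)%N) (fun _ _ _ yx zy => ltn_trans zy yx) col.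
split=> // x.
have [x1 xn] := row_bounds la_len x; have := cell_bounds x => /andP[_ /andP[+ _]].
rewrite nth0 => x2.
have zD : ((val x).1, 1%N) \in D.
  rewrite mem_skew_shape; move: (cell_bounds x).
  by case: (val x) => a b /=; rewrite !nth0; lia.
have Lxz : (L x <= L [` zD]%fset)%N.
  case: (ltngtP (val x).2 1%N) => [x20|x20|x21].
  - by rewrite ltnS leqNgt x2 in x20.
  - exact: rows.
  - have <- : x = [` zD]%fset; last exact: leqnn.
    by apply/val_inj/injective_projections.
apply: leq_ltn_trans Lxz (leq_trans (L_denom _) _).
by rewrite /denom /= addn1 leq_subLR -add1n leq_add2r.
Qed.

(** The corner cell has the largest ratio, and its denominator is n. *)
Lemma LHT_cornerE (n m : nat) (la : seq nat) :
  is_partition la -> (size la <= n)%N ->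
  LHT_corner n m (diagram la) = LHT n m (diagram la).
Proof.
move=> la_part la_len; apply/seteqP; split=> L [L_lh L_lt]; split=> // x.
  have [y y11 xy] := lh_ratio_le_corner x la_part L_lh.
  rewrite /floor_tableau floor_lt_int; apply: le_lt_trans xy _.
  have n0 := denominator_gt0 la_len (valP y).
  rewrite /lh_ratio ltr_pdivrMr ?ltr0z // y11 /content subrr addr0.
  by rewrite -[(m%:Z)%:~R]/(m%:R) -[(n%:Z)%:~R]/(n%:R) -natrM ltr_nat mulnC L_lt.
move=> x11; have := L_lt x; rewrite /floor_tableau floor_lt_int.
have n0 := denominator_gt0 la_len (valP x).
rewrite /lh_ratio ltr_pdivrMr ?ltr0z // x11 /content subrr addr0.
by rewrite -[(m%:Z)%:~R]/(m%:R) -[(n%:Z)%:~R]/(n%:R) -natrM ltr_nat mulnC.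
Qed.

(** * The hook length formula *)

Definition remove_column (la : seq nat) : seq nat :=
  [seq p.-1 | p <- la & (1 < p)%N].

Lemma partition_cons (a : nat) (la : seq nat) :
  is_partition (a :: la) -> is_partition la /\ all (geq a) la.
Proof.
have geq_trans : transitive geq by move=> x y z yx yz; exact: leq_trans yz yx.
rewrite /is_partition /= inE negb_or (path_sortedE geq_trans).
by move=> /andP[/andP[-> ->] /andP[_ ->]].
Qed.

Lemma nth_remove_column (la : seq nat) (i : nat) :
  is_partition la -> nth 0%N (remove_column la) i = (nth 0%N la i).-1.
Proof.
rewrite /remove_column; elim: la i => [|a la IH] i; first by rewrite !nth_nil.
move=> /partition_cons[la_part la_a] /=.
case: (ltnP 1 a) => [a1|a1] /=; first by case: i => [|i] //=; exact: IH.
have -> : [seq p <- la | (1 < p)%N] = [::].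
  apply/eqP; rewrite -size_eq0 size_filter -leqn0 leqNgt -has_count -all_predC.
  by apply: sub_all la_a => p /= pa; rewrite -leqNgt (leq_trans pa a1).
rewrite nth_nil; case: i => [|i] /=; first by lia.
have [i_la|i_la] := ltnP i (size la); last by rewrite nth_default.
by move: (all_nthP 0%N la_a i i_la) => /=; lia.
Qed.

Lemma remove_column_partition (la : seq nat) :
  is_partition la -> is_partition (remove_column la).
Proof.
have geq_trans : transitive geq by move=> x y z yx yz; exact: leq_trans yz yx.
move=> /andP[la_sorted la_pos]; apply/andP; split.
  apply: (homo_sorted (e := geq)) => [x y /= yx|]; first lia.
  exact: sorted_filter.
by apply/negP => /mapP[p]; rewrite mem_filter => /andP[p1 _]; lia.
Qed.

Lemma size_remove_column (la : seq nat) : (size (remove_column la) <= size la)%N.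
Proof. by rewrite size_map size_filter count_size. Qed.

(** By [standard_densityE] this is the proportion of standard tableaux among
all labellings of the shape.  The parameter [n] is kept because the determinant
is compared for la and for la without its first column at the same size. *)
Definition standard_density (n : nat) (la : seq nat) : rat :=
  invfact_det n (nth 0%N la) (nth 0%N [::]).

Lemma nth_nil_le (la : seq nat) (i : nat) : (nth 0 [::] i <= nth 0 la i)%N.
Proof. by rewrite nth_nil. Qed.

Lemma standard_densityE (n : nat) (la : seq nat) :
  is_partition la -> (size la <= n)%N ->
  standard_density n la =
  (ncard (SYT (diagram la)))%:R / (#|` diagram la|)`!%:R.
Proof.
move=> la_part la_len; rewrite diagramE.
have f0 : (#|` skew_shape la [::]|)`!%:R != 0 :> rat.
  by rewrite pnatr_eq0 -lt0n fact_gt0.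
by rewrite (@ncard_SYT_det n) // => [|i]; [rewrite mulrC mulKf|exact: nth_nil_le].
Qed.

(** Rows of the matrix are indexed by k = n - j with j from 1, and Pascal's
rule expresses the row of k for l + 1 through the rows of k and k - 1 for l. *)
Lemma lh_det_pascal (n : nat) (lam lam' : nat -> nat) :
  (forall i, (i < n)%N -> lam i = (lam' i).+1) ->
  lh_det n 1 lam (nth 0%N [::]) = lh_det n 1 lam' (nth 0%N [::]).
Proof.
move=> lamE; pose U : 'M[rat]_n :=
  \matrix_(j, k) ((k == j)%:R + (k == j.+1 :> nat)%:R).
have detU : \det U = 1.
  rewrite -det_tr det_trig => [|].
    by apply: big1 => i _; rewrite !mxE eqxx ltn_eqF ?addr0.
  apply/is_trig_mxP => i j ij; rewrite !mxE.
  by rewrite -val_eqE /= !ltn_eqF ?addr0 // ltnW.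
rewrite -[RHS]mul1r -detU /lh_det -det_mulmx; congr (\det _).
apply/matrixP => j i; rewrite !mxE /=.
under eq_bigr do rewrite !mxE exp1n muln1 mulrDl.
rewrite big_split /= exp1n muln1 (bigD1 j) //= eqxx mul1r big1 ?addr0; last first.
  by move=> k /negbTE ->; rewrite mul0r.
rewrite /shifted lamE // !nth_nil !add0n addSn.
have [jn|nj] := ltnP j.+1 n; last first.
  rewrite (_ : n - j.+1 = 0)%N ?bin0; last by lia.
  rewrite big1 ?addr0 // => k _.
  by rewrite ltn_eqF ?mul0r // (leq_trans (ltn_ord k)).
rewrite (bigD1 (Ordinal jn)) //= eqxx mul1r big1 ?addr0; last first.
  by move=> k; rewrite -val_eqE /= => /negbTE ->; rewrite mul0r.
by rewrite -(subnSK jn) binS natrD.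
Qed.

Lemma standard_density_remove_column (la : seq nat) :
  is_partition la ->
  standard_density (size la) la *
    \prod_(i < size la) (shifted (size la) (nth 0%N la) i)%:R =
  standard_density (size la) (remove_column la).
Proof.
move=> la_part; set n := size la.
have la_pos i : (i < n)%N -> nth 0%N la i = (nth 0%N (remove_column la) i).+1.
  move=> i_n; rewrite nth_remove_column // prednK // lt0n.
  by case/andP: la_part => _; apply: contraNneq => <-; exact: mem_nth.
have := lh_det_pascal la_pos; rewrite !lh_detE; try exact: nth_nil_le.
rewrite !expr1n !mul1r; set c := \prod_(i < n) _ => E.
set c' := \prod_(i < n) _ in E.
have cE : c = \prod_(i < n) (shifted n (nth 0%N la) i)%:R * c'.
  rewrite -big_split; apply: eq_bigr => i _ /=.
  rewrite {1 2}/shifted la_pos // addSn factS natrM mulrA; congr (_ * _ / _).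
  by rewrite /shifted la_pos // addSn.
have c'0 : c' != 0.
  apply/prodf_neq0 => i _; rewrite mulf_neq0 ?invr_neq0 // pnatr_eq0 -lt0n;
    exact: fact_gt0.
apply: (mulfI c'0); rewrite /standard_density -E cE; ring.
Qed.

Lemma hook_remove_column (la : seq nat) (i j : nat) :
  is_partition la -> (j.+1 < nth 0 la i)%N ->
  hook la (i.+1, j.+2) = hook (remove_column la) (i.+1, j.+1).
Proof.
move=> la_part j_la; rewrite /hook /part /= nth_remove_column //.
have -> : conj_part (remove_column la) j.+1 = conj_part la j.+2.
  rewrite /conj_part count_map count_filter; apply: eq_count => p /=; lia.
lia.
Qed.

Lemma hook_first_column (la : seq nat) (i : nat) :
  is_partition la -> (i < size la)%N ->
  hook la (i.+1, 1%N) = (shifted (size la) (nth 0%N la) i)%:Z.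
Proof.
move=> /andP[_ la_pos] i_la; rewrite /hook /part /conj_part /shifted /=.
have -> : count (fun p => (0 < p)%N) la = size la.
  apply/eqP; rewrite -all_count; apply/allP => p p_la; rewrite lt0n.
  by apply: contraNneq la_pos => <-.
lia.
Qed.

Definition hook_product (la : seq nat) : rat :=
  \prod_(x <- diagram la) (hook la x)%:~R.

Lemma hook_product_remove_column (la : seq nat) :
  is_partition la ->
  hook_product la =
  \prod_(i < size la) (shifted (size la) (nth 0%N la) i)%:R *
  hook_product (remove_column la).
Proof.
move=> la_part; rewrite /hook_product !diagramE.
rewrite (big_skew_shape _ _ _ (leqnn (size la))).
rewrite (big_skew_shape _ _ _ (size_remove_column la)) -big_split.
apply: eq_bigr => i _ /=; rewrite !nth_nil.
have la_i : (0 < nth 0 la i)%N.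
  by case/andP: la_part => _; rewrite lt0n; apply: contraNneq => <-; exact: mem_nth.
rewrite nth_remove_column // -{1}(prednK la_i) big_nat_recl //.
rewrite hook_first_column //; congr (_ * _); apply: eq_big_nat => j j_la.
by rewrite hook_remove_column //; lia.
Qed.

(** Induction on the length of the first row.  The number of rows may drop when
the first column is removed, which is why the statement allows any larger
[n]. *)
Theorem hook_length_formula (n : nat) (la : seq nat) :
  is_partition la -> (size la <= n)%N ->
  standard_density n la * hook_product la = 1.
Proof.
move Ek: (nth 0%N la 0) => k.
elim: k la n Ek => [|k IH] la n la0 la_part la_len.
  have -> : la = [::].
    case: la la0 la_part {la_len} => // a la /= -> /andP[_].
    by rewrite inE eqxx.
  rewrite (@standard_densityE n) // -(@standard_densityE 0 [::]) //.
  rewrite /standard_density /invfact_det det_mx00 mul1r /hook_product.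
  rewrite big_seq big1 // => x.
  by rewrite diagramP /=; lia.
rewrite standard_densityE // -(standard_densityE la_part (leqnn _)).
rewrite hook_product_remove_column // mulrA standard_density_remove_column //.
rewrite IH ?nth_remove_column ?la0 ?remove_column_partition //.
exact: size_remove_column.
Qed.

(** * The enumeration of lecture hall tableaux *)

Theorem corollary1p3 (n m : nat) (la mu : seq nat)
    (la_part : is_partition la) (mu_part : is_partition mu)
    (mu_sub_la : diagram mu `<=` diagram la) (la_len : (size la <= n)%N) :
  (ncard (LHT n m (skew_shape la mu)))%:R =
    m%:R ^+ #|` skew_shape la mu| *
    ((ncard (SYT (skew_shape la mu)))%:R / (#|` skew_shape la mu|)`!%:R) *
    \prod_(x <- skew_shape la mu) (n%:Z + content x)%:~R :> rat
  /\
  [/\ ncard (LHT_corner n m (diagram la)) = ncard (LHT n m (diagram la)),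
      ncard (LHT n m (diagram la)) =
        (m ^ #|` diagram la| * ncard (SSYT n (diagram la)))%N
    & (ncard (LHT n m (diagram la)))%:R =
        m%:R ^+ #|` diagram la| *
        \prod_(x <- diagram la)
          ((n%:Z + content x)%:~R / (hook la x)%:~R) :> rat].
Proof.
split; first exact: ncard_LHT_skew (nth_le_of_diagram mu_sub_la) la_len.
have straight k : (ncard (LHT n k (diagram la)))%:R =
    k%:R ^+ #|` diagram la| * standard_density n la *
    \prod_(x <- diagram la) (n%:Z + content x)%:~R :> rat.
  rewrite standard_densityE // diagramE ncard_LHT_skew // => i.
  exact: nth_nil_le.
split.
- by rewrite LHT_cornerE.
- rewrite SSYT_LHT1 //; apply/eqP; rewrite -(eqr_nat rat) natrM natrX.
  by rewrite !straight expr1n mul1r mulrA.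
- rewrite straight -mulrA; congr (_ * _); rewrite big_split prodfV /= mulrC.
  congr (_ * _); have E := hook_length_formula la_part la_len.
  have h0 : hook_product la != 0.
    by apply/eqP => h0; move/eqP: E; rewrite h0 mulr0 eq_sym oner_eq0.
  by apply: (mulIf h0); rewrite E mulVf.
Qed.
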